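(* There is an algorithm that, given a paper strip with $n$ creases $p_1,\dots,p_n$ at positions $0=x_0<x_1<\dots<x_n<x_{n+1}$, a mountain-valley string $s\in\{M,V\}^n$, and a natural number $k$, decides whether the strip has a leveled folded state with respect to $s$ of height at most $k$, in time $O(2^{O(k\log k)}n)$.
   Context: A paper strip is the segment $[0,x_{n+1}]$ of the $x$-axis, rigid except at creases $p_i$ located at $x_i$ ($1\le i\le n$); write $p_0,p_{n+1}$ for the ends. The segments are $S_i=[x_i,x_{i+1}]$, $0\le i\le n$, so crease $p_i$ joins $S_{i-1}$ and $S_i$. In a flat folding every crease is folded by $180^\circ$: the folding map $f$ is determined by $f(p_0)=0$, $S_0$ is mapped to $[0,x_1]$, and consecutive segments alternate direction, so $f(p_{i+1})=f(p_i)\pm |S_i|$ with alternating signs ($+$ for even $i$, $-$ for odd $i$); the image of $S_i$ is the interval between $f(p_i)$ and $f(p_{i+1})$. Segment $S_i$ is face-up if $i$ is even and face-down if $i$ is odd. Crease letter $M$ (mountain) means the bottom sides of the two joined segments face each other, $V$ (valley) that the top sides face each other; concretely $S_i$ must lie above $S_{i-1}$ iff ($s_i=V$ and $i$ odd) or ($s_i=M$ and $i$ even), and below otherwise. A folded state is a vertical order (a strict total order on each set of segments whose images share an interior point, consistent and transitive) on segments whose images overlap in an interval of positive length, which respects these mountain-valley constraints and is non-crossing: (1) if $S_{i-1},S_i$ are joined at crease $p_i$ at $x$-coordinate $f(p_i)$, then every segment $S$ whose image extends strictly to both sides of $f(p_i)$ satisfies either $S<S_{i-1},S_i$ or $S>S_{i-1},S_i$;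 (2) if two creases are mapped to the same $x$-coordinate and all four segments they join extend to the same side of it, the two creases do not interleave, i.e. there is no $A<B<A'<B'$ with $\{A,A'\}$ the pair joined at one crease and $\{B,B'\}$ the pair joined at the other. A leveled folded state is an assignment of each segment to a level in $\{1,2,\dots\}$ (segments with overlapping images getting distinct levels) such that the induced vertical order (by level) is a folded state. Its height is the number of levels used. *)

(* Defs.v *)
From HB Require Import structures.
From mathcomp Require Import all_boot all_order all_algebra.
From mathcomp Require Import reals.

Set Implicit Arguments.
Unset Strict Implicit.
Unset Printing Implicit Defensive.

Import Order.TTheory GRing.Theory Num.Theory.
Local Open Scope ring_scope.

(** * Strips and folded states *)

Inductive crease_letter := Mountain | Valley.

(* The strip is given by its tuple x_0, ..., x_{n+1} of positions. *)
Definition paper_strip (R : realType) (n : nat) (x : n.+2.-tuple R) : Prop :=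
  x`_0 = 0 /\ forall i : nat, (i <= n)%N -> x`_i < x`_i.+1.

(* [fold_map x i] is f(p_i). *)
Fixpoint fold_map (R : realType) (n : nat) (x : n.+2.-tuple R) (i : nat) : R :=
  if i is j.+1 then
    fold_map x j + (if odd j then -1 else 1) * (x`_j.+1 - x`_j)
  else 0.

Definition img_lo (R : realType) (n : nat) (x : n.+2.-tuple R) (A : 'I_n.+1) : R :=
  Num.min (fold_map x A) (fold_map x A.+1).

Definition img_hi (R : realType) (n : nat) (x : n.+2.-tuple R) (A : 'I_n.+1) : R :=
  Num.max (fold_map x A) (fold_map x A.+1).

Definition covers (R : realType) (n : nat) (x : n.+2.-tuple R) (A : 'I_n.+1)
    (y : R) : bool :=
  img_lo x A < y < img_hi x A.

Definition overlap (R : realType) (n : nat) (x : n.+2.-tuple R)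
    (A B : 'I_n.+1) : bool :=
  Num.max (img_lo x A) (img_lo x B) < Num.min (img_hi x A) (img_hi x B).

(* Creases are indexed from 0: the ordinal i : 'I_n stands for p_{i+1}, whose
   letter is [tnth s i] and which joins S_i and S_{i+1}. *)
Definition seg_before (n : nat) (i : 'I_n) : 'I_n.+1 := widen_ord (leqnSn n) i.
Definition seg_after (n : nat) (i : 'I_n) : 'I_n.+1 := lift ord0 i.
Definition crease_img (R : realType) (n : nat) (x : n.+2.-tuple R) (i : 'I_n) : R :=
  fold_map x i.+1.

Definition joined (n : nat) (i : 'I_n) : {set 'I_n.+1} :=
  [set seg_before i; seg_after i].

(* [lt A B] reads "A is below B".  It only relates overlapping segments, and at
   each point it orders strictly and totally the segments covering that point.
   Three pairwise overlapping intervals share an interior point, so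
   transitivity at each point gives transitivity on every pairwise overlapping
   triple. *)
Record vertical_order (R : realType) (n : nat) (x : n.+2.-tuple R)
    (lt : rel 'I_n.+1) : Prop := VerticalOrder {
  vo_overlap : forall A B, lt A B -> overlap x A B;
  vo_irr : forall y A, covers x A y -> ~~ lt A A;
  vo_trans : forall y A B C, covers x A y -> covers x B y -> covers x C y ->
    lt A B -> lt B C -> lt A C;
  vo_total : forall y A B, covers x A y -> covers x B y -> A != B ->
    lt A B || lt B A
}.

(* [goes_above c i]: with letter c at p_i (numbered from 1), S_i must lie
   above S_{i-1}. *)
Definition goes_above (c : crease_letter) (i : nat) : bool :=
  match c with Valley => odd i | Mountain => ~~ odd i end.

Definition respects_mv (n : nat) (s : n.-tuple crease_letter)
    (lt : rel 'I_n.+1) : Prop :=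
  forall i : 'I_n,
    if goes_above (tnth s i) i.+1 then lt (seg_before i) (seg_after i)
    else lt (seg_after i) (seg_before i).

Definition no_segment_crossing (R : realType) (n : nat) (x : n.+2.-tuple R)
    (lt : rel 'I_n.+1) : Prop :=
  forall (i : 'I_n) (A : 'I_n.+1), covers x A (crease_img x i) ->
    (lt A (seg_before i) /\ lt A (seg_after i)) \/
    (lt (seg_before i) A /\ lt (seg_after i) A).

Definition same_side (R : realType) (n : nat) (x : n.+2.-tuple R)
    (y : R) (D : {set 'I_n.+1}) : Prop :=
  (forall A, A \in D -> y < img_hi x A) \/ (forall A, A \in D -> img_lo x A < y).

Definition no_crease_crossing (R : realType) (n : nat) (x : n.+2.-tuple R)
    (lt : rel 'I_n.+1) : Prop :=
  forall i j : 'I_n, i != j -> crease_img x i = crease_img x j ->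
    same_side x (crease_img x i) (joined i :|: joined j) ->
    forall A A' B B' : 'I_n.+1,
      [set A; A'] = joined i -> [set B; B'] = joined j ->
      ~ [/\ lt A B, lt B A' & lt A' B'].

Definition folded_state (R : realType) (n : nat) (x : n.+2.-tuple R)
    (s : n.-tuple crease_letter) (lt : rel 'I_n.+1) : Prop :=
  [/\ vertical_order x lt, respects_mv s lt,
      no_segment_crossing x lt & no_crease_crossing x lt].

Definition level_order (R : realType) (n : nat) (x : n.+2.-tuple R)
    (lev : 'I_n.+1 -> nat) : rel 'I_n.+1 :=
  fun A B => overlap x A B && (lev A < lev B)%N.

Definition leveled_folded_state (R : realType) (n : nat) (x : n.+2.-tuple R)
    (s : n.-tuple crease_letter) (lev : 'I_n.+1 -> nat) : Prop :=
  [/\ forall A, (1 <= lev A)%N,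
      forall A B, A != B -> overlap x A B -> lev A != lev B
    & folded_state x s (level_order x lev)].

Definition height (n : nat) (lev : 'I_n.+1 -> nat) : nat :=
  size (undup (codom lev)).

(** * Machine model

   A real RAM with uniform cost, programmed in a structured language.  The
   memory consists of integer arrays and real arrays, both named by naturals; a
   program mentions finitely many arrays, so they could be interleaved in one
   bank at the cost of a constant factor.  Integer cells hold naturals and
   support addition and truncated subtraction; real cells hold exact reals and
   support addition and subtraction.  Both can be compared.  There is no
   multiplication, no rounding and no conversion between the two sorts.  Every
   operation, array access and test costs one unit. *)

Record memory (R : realType) := Memory {
  ints : nat -> nat -> nat;
  reals : nat -> nat -> R
}.

Inductive iexp :=
  | IConst of nat
  | IGet of nat & iexp  (* array name, index *)
  | IAdd of iexp & iexp
  | ISub of iexp & iexp.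

Inductive rexp :=
  | RGet of nat & iexp  (* array name, index *)
  | RAdd of rexp & rexp
  | RSub of rexp & rexp.

Inductive bexp :=
  | BILe of iexp & iexp
  | BRLe of rexp & rexp
  | BNot of bexp
  | BAnd of bexp & bexp.

Inductive cmd :=
  | Skip
  | ISet of nat & iexp & iexp  (* array name, index, value *)
  | RSet of nat & iexp & rexp  (* array name, index, value *)
  | Seq of cmd & cmd
  | If of bexp & cmd & cmd
  | While of bexp & cmd.

Fixpoint ieval (R : realType) (m : memory R) (e : iexp) : nat :=
  match e with
  | IConst c => c
  | IGet a e1 => ints m a (ieval m e1)
  | IAdd e1 e2 => (ieval m e1 + ieval m e2)%N
  | ISub e1 e2 => (ieval m e1 - ieval m e2)%N
  end.

Fixpoint reval (R : realType) (m : memory R) (e : rexp) : R :=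
  match e with
  | RGet a e1 => reals m a (ieval m e1)
  | RAdd e1 e2 => reval m e1 + reval m e2
  | RSub e1 e2 => reval m e1 - reval m e2
  end.

Fixpoint beval (R : realType) (m : memory R) (b : bexp) : bool :=
  match b with
  | BILe e1 e2 => (ieval m e1 <= ieval m e2)%N
  | BRLe e1 e2 => reval m e1 <= reval m e2
  | BNot b1 => ~~ beval m b1
  | BAnd b1 b2 => beval m b1 && beval m b2
  end.

Fixpoint icost (e : iexp) : nat :=
  match e with
  | IConst _ => 1
  | IGet _ e1 => (icost e1).+1
  | IAdd e1 e2 | ISub e1 e2 => (icost e1 + icost e2).+1
  end.

Fixpoint rcost (e : rexp) : nat :=
  match e with
  | RGet _ e1 => (icost e1).+1
  | RAdd e1 e2 | RSub e1 e2 => (rcost e1 + rcost e2).+1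
  end.

Fixpoint bcost (b : bexp) : nat :=
  match b with
  | BILe e1 e2 => (icost e1 + icost e2).+1
  | BRLe e1 e2 => (rcost e1 + rcost e2).+1
  | BNot b1 => (bcost b1).+1
  | BAnd b1 b2 => (bcost b1 + bcost b2).+1
  end.

Definition upd (T : Type) (h : nat -> nat -> T) (a j : nat) (v : T) :
    nat -> nat -> T :=
  fun b i => if (b == a) && (i == j) then v else h b i.

Definition iset (R : realType) (m : memory R) (a j v : nat) : memory R :=
  Memory (upd (ints m) a j v) (reals m).

Definition rset (R : realType) (m : memory R) (a j : nat) (v : R) : memory R :=
  Memory (ints m) (upd (reals m) a j v).

(* [exec c m t m']: started in memory m, c halts in memory m' after t steps. *)
Inductive exec (R : realType) : cmd -> memory R -> nat -> memory R -> Prop :=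
  | ExecSkip m : exec Skip m 1 m
  | ExecISet m a e v :
      exec (ISet a e v) m (icost e + icost v).+1
        (iset m a (ieval m e) (ieval m v))
  | ExecRSet m a e v :
      exec (RSet a e v) m (icost e + rcost v).+1
        (rset m a (ieval m e) (reval m v))
  | ExecSeq c1 c2 m1 m2 m3 t1 t2 :
      exec c1 m1 t1 m2 -> exec c2 m2 t2 m3 ->
      exec (Seq c1 c2) m1 (t1 + t2)%N m3
  | ExecIf b c1 c2 m m' t :
      exec (if beval m b then c1 else c2) m t m' ->
      exec (If b c1 c2) m (bcost b + t).+1 m'
  | ExecWhileEnd b c m :
      ~~ beval m b -> exec (While b c) m (bcost b).+1 m
  | ExecWhileStep b c m1 m2 m3 t1 t2 :
      beval m1 b -> exec c m1 t1 m2 -> exec (While b c) m2 t2 m3 ->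
      exec (While b c) m1 (bcost b + t1 + t2).+1 m3.

(* Execution is deterministic, so the running time and the answer of a halting
   program are well defined. *)
Lemma exec_det (R : realType) (c : cmd) (m : memory R) (t1 t2 : nat)
    (m1 m2 : memory R) :
  exec c m t1 m1 -> exec c m t2 m2 -> t1 = t2 /\ m1 = m2.
Proof.
move=> E1; elim: E1 t2 m2 => {c m t1 m1}.
- by move=> m t2 m2 E2; inversion E2.
- by move=> m a e v t2 m2 E2; inversion E2.
- by move=> m a e v t2 m2 E2; inversion E2.
- move=> c1 c2 m1 m2 m3 t1 t2 _ IH1 _ IH2 t m E2.
  inversion E2 as [| | |? ? ? ? ? ? ? F1 F2| | |]; subst.
  by have [? ?] := IH1 _ _ F1; subst; have [? ?] := IH2 _ _ F2; subst.
- move=> b c1 c2 m m' t _ IH t2 m2 E2.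
  inversion E2 as [| | | |? ? ? ? ? ? F| |]; subst.
  by have [? ?] := IH _ _ F; subst.
- move=> b c m nb t2 m2 E2; inversion E2 as [| | | | |? ? ? F|? ? ? ? ? ? ? F];
    subst => //.
  by rewrite F in nb.
- move=> b c m1 m2 m3 t1 t2 hb _ IH1 _ IH2 t m E2.
  inversion E2 as [| | | | |? ? ? F|? ? ? ? ? ? ? F F1 F2]; subst.
    by rewrite hb in F.
  by have [? ?] := IH1 _ _ F1; subst; have [? ?] := IH2 _ _ F2; subst.
Qed.

Definition letter_code (c : crease_letter) : nat :=
  match c with Mountain => 0 | Valley => 1 end.

(* Input layout: integer array 0 holds n at index 0 and k at index 1; integer
   array 1 holds the code of the letter of p_i at index i, for 1 <= i <= n; real
   array 0 holds x_i at index i, for 0 <= i <= n+1.  All other cells are 0. *)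
Definition input (R : realType) (n : nat) (x : n.+2.-tuple R)
    (s : n.-tuple crease_letter) (k : nat) : memory R :=
  Memory
    (fun a i => match a with
                | 0 => nth 0%N [:: n; k] i
                | 1 => nth 0%N (0%N :: [seq letter_code c | c <- s]) i
                | _ => 0%N
                end)
    (fun a i => if a is 0 then x`_i else 0).

(* The answer is read in cell 0 of integer array 2; nonzero means yes. *)
Definition answers_yes (R : realType) (m : memory R) : bool :=
  ints m 2 0 != 0%N.

(* Main.v *)
Require Import Defs.
From mathcomp Require Import all_boot all_order all_algebra.
From mathcomp Require Import reals.
From mathcomp Require Import zify.

Set Implicit Arguments.
Unset Strict Implicit.
Unset Printing Implicit Defensive.

Import Order.TTheory GRing.Theory Num.Theory.

(** After relabelling, a leveling uses the levels 0, ..., k-1, and every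
    condition on a folded state only concerns at most four segments whose images
    share an interior point.  Sweeping the segments by increasing left end, all
    such cliques show up inside a "bag" of segments met just to the right of the
    current left end, and a bag has at most k members unless there is no leveling.
    So a dynamic program over the level assignments of the current bag, at most
    k^k of them, decides the question.

    Linear time in n requires sorting the left ends without a log n factor: an
    insertion sort whose cursor moves from one segment to the next one of the
    strip.  The cursor only jumps over left ends lying in the image of one of the
    two segments, so all its moves number at most 2 k (n+1) if a leveling exists;
    when this budget is exhausted the answer is no. *)

(** * Cliques of segments *)

(** The target $2^{O(k\log k)}n$ leaves any fixed power of $k^k$ affordable, so nothing inside one
    sweep step is optimised: every level assignment is compared with every other, division is
    repeated subtraction, all quadruples of slots are tested. What has to be protected is the factor
    $n$, and on every input, also when there is no leveling and arbitrarily many segments overlap.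
    Hence each phase carries its own cutoff: the sort a credit of moves, the sweep a fixed supply of
    $k$ slots. Exhausting either refutes a leveling for the same reason: levels are injective on a
    clique.

    The machine has neither multiplication nor sets, so a level assignment of the slots is a number
    below $k^k$ read in base $k$ (a word), and a family of assignments is an array indexed by words.
    An ended segment keeps its slot and its level until the slot is reused; thus each step forgets
    exactly one digit and writes exactly one. *)

Section Constraints.
Variables (R : realType) (lo hi F : nat -> R) (up : nat -> bool).

(** By Helly's theorem on the line, these comparisons of ends (diagonal included) say that the open
    images have a common point, without naming the point. *)
Definition clique (s : seq nat) : bool :=
  all (fun a => all (fun b => lo a < hi b)%R s) s.

(** Only the interleavings that begin with the first crease are excluded. Those that begin with the
    second come from the instance of [local_ok] with the two creases exchanged. *)
Definition nested (a a' b b' : nat) : bool :=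
  [&& ~~ [&& a < b, b < a' & a' < b'], ~~ [&& a' < b, b < a & a < b'],
      ~~ [&& a < b', b' < a' & a' < b] & ~~ [&& a' < b', b' < a & a < b]].

(** Arguments may coincide, so conditions on two or three segments are instances of this one
    predicate. The same-side condition on two creases is expressed by the four segments forming a
    clique. *)
Definition local_ok (i j p q li lj lp lq : nat) : bool :=
  ((i != j) ==> (li != lj)) &&
  ((j == i.+1) ==>
   [&& if up i then li < lj else lj < li,
       (lo p < F i)%R && (F i < hi p)%R ==>
         ((lp < li) && (lp < lj)) || ((li < lp) && (lj < lp))
     & [&& q == p.+1, i != p & F i == F p] ==> nested li lj lp lq]).

Definition valid_levels (N : nat) (lev : nat -> nat) : Prop :=
  forall i j p q, i < N -> j < N -> p < N -> q < N ->
    clique [:: i; j; p; q] -> local_ok i j p q (lev i) (lev j) (lev p) (lev q).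

Definition solution (N k : nat) (lev : nat -> nat) : Prop :=
  (forall i, i < N -> lev i < k) /\ valid_levels N lev.

Lemma cliqueP (s : seq nat) :
  reflect (forall a b, a \in s -> b \in s -> (lo a < hi b)%R) (clique s).
Proof.
apply: (iffP allP) => [H a b ha hb|H a ha]; first exact: (allP (H _ ha)).
by apply/allP => b hb; exact: H.
Qed.

Lemma clique_sub (s s' : seq nat) :
  {subset s' <= s} -> clique s -> clique s'.
Proof. by move=> h /cliqueP H; apply/cliqueP => a b /h ha /h hb; exact: H. Qed.

(** Pigeonhole on the distinct levels of a clique; both cutoffs of the program rest on this
    bound. *)
Lemma solution_depth N k lev s :
  solution N k lev -> uniq s -> all (fun i => i < N) s -> clique s -> size s <= k.
Proof.
move=> [hb hv] us /allP sN cs.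
rewrite -(size_map lev s) -[k in _ <= k](size_iota 0).
apply: uniq_leq_size; last first.
  by move=> _ /mapP[i hi_s ->]; rewrite mem_iota add0n; apply/hb/sN.
rewrite map_inj_in_uniq // => i j hi_s hj_s e; apply/eqP; apply/negPn/negP => ne.
have cij : clique [:: i; j; i; i].
  by apply: clique_sub cs => a; rewrite !inE => /or4P[] /eqP->.
have := hv i j i i (sN _ hi_s) (sN _ hj_s) (sN _ hi_s) (sN _ hi_s) cij.
by case/andP => /implyP/(_ ne); rewrite e eqxx.
Qed.

Definition starts_within (N i : nat) : nat :=
  count (fun b => (lo i <= lo b)%R && (lo b < hi i)%R) (iota 0 N).

(** Double counting: for a fixed [b], the segments [i] that count it all contain the points just to
    the right of [lo b], hence form a clique. *)
Lemma sum_starts_within N k lev :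
  solution N k lev -> \sum_(0 <= i < N) starts_within N i <= k * N.
Proof.
move=> sol.
have -> : \sum_(0 <= i < N) starts_within N i =
  \sum_(0 <= b < N) count (fun i => (lo i <= lo b)%R && (lo b < hi i)%R) (iota 0 N).
  under eq_bigr do rewrite /starts_within -sum1_count big_mkcond /=.
  rewrite /index_iota subn0 exchange_big /=.
  by under eq_bigr do rewrite -big_mkcond sum1_count.
apply: (@leq_trans (\sum_(0 <= b < N) k)); last by rewrite sum_nat_const_nat subn0 mulnC.
apply: leq_sum => b _; rewrite -size_filter.
apply: (solution_depth sol); first by rewrite filter_uniq ?iota_uniq.
  by apply/allP => i; rewrite mem_filter mem_iota => /andP[_].
apply/cliqueP => a c; rewrite !mem_filter => /andP[/andP[h1 _] _] /andP[/andP[_ h2] _].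
exact: le_lt_trans h1 h2.
Qed.

End Constraints.

Definition digit (k a w : nat) : nat := (w %/ k ^ a) %% k.

Lemma digit_lt k a w : 0 < k -> digit k a w < k.
Proof. by move=> k0; rewrite ltn_pmod. Qed.

Lemma digits_surj k m (w : nat -> nat) :
  (forall a, a < m -> w a < k) ->
  exists2 v, v < k ^ m & forall a, a < m -> digit k a v = w a.
Proof.
elim: m w => [|m IH] w hw; first by exists 0.
have [a hm|v vk hv] := IH (fun a => w a.+1); first exact: hw.
have w0 := hw 0 isT; have k0 : 0 < k by lia.
exists (w 0 + v * k) => [|[|a] ha]; first by rewrite expnS; nia.
  by rewrite /digit expn0 divn1 addnC modnMDl modn_small.
by rewrite /digit expnS divnMA addnC divnMDl // (divn_small w0) addn0; apply: hv.
Qed.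

(** * Dynamic program over the sorted segments *)

Section Sweep.
Variables (R : realType) (lo hi F : nat -> R) (up : nat -> bool) (N k : nat).
Variable z : seq nat.
Hypothesis lohi : forall i, i < N -> (lo i < hi i)%R.
Hypothesis zperm : perm_eq z (iota 0 N).
Hypothesis zsorted : sorted (fun a b => lo a <= lo b)%R z.

Let loc i j p q lev := local_ok lo hi F up i j p q (lev i) (lev j) (lev p) (lev q).

Lemma size_z : size z = N.
Proof. by rewrite (perm_size zperm) size_iota. Qed.

Lemma uniq_z : uniq z.
Proof. by rewrite (perm_uniq zperm) iota_uniq. Qed.

Lemma mem_z i : (i \in z) = (i < N).
Proof. by rewrite (perm_mem zperm) mem_iota. Qed.

Lemma z_le u v : u <= v -> v < N -> (lo (nth 0 z u) <= lo (nth 0 z v))%R.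
Proof.
move=> uv vN; apply: (sorted_leq_nth _ _ 0 zsorted) => //.
- by move=> a b c; exact: le_trans.
- by rewrite inE size_z (leq_ltn_trans uv).
- by rewrite inE size_z.
Qed.

Lemma nth_z t : t < N -> nth 0 z t < N.
Proof. by move=> tN; rewrite -mem_z mem_nth ?size_z. Qed.

(** Ties between left ends do no harm: the tied segment that comes last in [z] has all the others in
    its bag. *)
Definition bag (u i : nat) : bool := (i \in take u.+1 z) && (lo (nth 0 z u) < hi i)%R.

Definition valid_upto (t : nat) (lev : nat -> nat) : Prop :=
  forall u i j p q, u < t -> bag u i -> bag u j -> bag u p -> bag u q -> loc i j p q lev.

Lemma mem_take_z u i : i < N -> (i \in take u z) = (index i z < u).
Proof. by move=> iN; rewrite in_take // mem_z. Qed.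

Lemma bag_lt u i : bag u i -> i < N.
Proof. by case/andP => /mem_take; rewrite mem_z. Qed.

Lemma bag_lo u i : u < N -> bag u i -> (lo i <= lo (nth 0 z u))%R.
Proof.
move=> uN b; have iN := bag_lt b; case/andP: b; rewrite mem_take_z // ltnS => iu _.
by have := z_le iu uN; rewrite nth_index // mem_z.
Qed.

(** A clique lies in the bag of its member that comes last in [z]: the others have been met by then
    and reach past its left end. *)
Lemma valid_uptoP lev : valid_levels lo hi F up N lev <-> valid_upto N lev.
Proof.
split=> [H u i j p q uN bi bj bp bq|H i j p q iN jN pN qN /cliqueP cl].
  apply: H; rewrite ?(bag_lt bi) ?(bag_lt bj) ?(bag_lt bp) ?(bag_lt bq) //.
  have aux a b : bag u a -> bag u b -> (lo a < hi b)%R.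
    by move=> ba /andP[_]; apply: le_lt_trans; exact: bag_lo.
  by apply/cliqueP => a b; rewrite !inE => /or4P[] /eqP-> /or4P[] /eqP->; apply: aux.
set s := [:: i; j; p; q] in cl.
have [m ms mmax] : exists2 m, m \in s & forall a, a \in s -> index a z <= index m z.
  have /= [m hm1 hm2] := @arg_maxnP _ (Ordinal (isT : 0 < size s)) xpredT
     (fun o : 'I_(size s) => index (nth 0 s o) z) isT.
  exists (nth 0 s m) => [|a as_]; first exact: mem_nth.
  have ha : index a s < size s by rewrite index_mem.
  by have := hm2 (Ordinal ha) isT; rewrite /= nth_index.
have sN a : a \in s -> a < N by rewrite !inE => /or4P[] /eqP->.
have uN : index m z < N by rewrite -[N]size_z index_mem mem_z sN.
have bg a : a \in s -> bag (index m z) a.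
  by move=> as_; rewrite /bag mem_take_z ?sN // ltnS mmax // nth_index ?mem_z ?sN ?cl.
by apply: (H (index m z)); rewrite ?bg // /s !inE eqxx ?orbT.
Qed.

(** The word fixes the levels of the occupants only. Quantifying away the levels of evicted segments
    is what keeps the state of the sweep finite. *)
Definition compatible (t : nat) (occ w lev : nat -> nat) : Prop :=
  [/\ forall i, i \in take t z -> lev i < k, valid_upto t lev
    & forall s, s < k -> occ s != 0 -> lev (occ s).-1 = w s].

(* [occ s] is one plus the segment most recently put in slot [s], or 0; a
   segment may stay in its slot after the sweep has left it. *)
Record sweep_inv (t : nat) (occ : nat -> nat) (reach : nat -> bool) : Prop := SweepInv {
  si_mem : forall s, s < k -> occ s != 0 -> (occ s).-1 \in take t z;
  si_placed : forall i, i \in take t z ->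
    (exists2 s, s < k & occ s = i.+1) \/ (exists2 v, v < t & (hi i <= lo (nth 0 z v))%R);
  si_inj : forall s s', s < k -> s' < k -> occ s = occ s' -> occ s != 0 -> s = s';
  si_reach : forall v, v < k ^ k ->
    reach v <-> exists lev, compatible t occ (fun s => digit k s v) lev
}.

Lemma sweep_final occ reach : sweep_inv N occ reach ->
  (exists2 v, v < k ^ k & reach v) <-> exists lev, solution lo hi F up N k lev.
Proof.
move=> I; split=> [[v vq] /(si_reach I vq)[lev [h1 h2 _]]|[lev [h1 h2]]].
  exists lev; split; last exact/valid_uptoP.
  by move=> i iN; apply: h1; rewrite take_oversize ?size_z // mem_z.
(* An empty slot puts no constraint on its digit, so 0 serves. *)
have [|v vq hv] := @digits_surj k k (fun s => if occ s == 0 then 0 else lev (occ s).-1).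
- move=> s sk /=; case: ifP => [_|/negbT h]; first by lia.
  by apply: h1; rewrite -mem_z; exact: mem_take (si_mem I sk h).
exists v => //; apply/(si_reach I vq); exists lev; split.
- by move=> i /mem_take; rewrite mem_z; exact: h1.
- exact/valid_uptoP.
- by move=> s sk h; rewrite hv // (negbTE h).
Qed.

Lemma take_zS t : t < N -> take t.+1 z = rcons (take t z) (nth 0 z t).
Proof. by move=> tN; rewrite -take_nth ?size_z. Qed.

Lemma notin_take_z t : t < N -> nth 0 z t \notin take t z.
Proof. by move=> tN; rewrite mem_take_z ?nth_z // index_uniq ?size_z ?uniq_z // ltnn. Qed.

(** Together with the new segment, the [k] active occupants would form a clique of size [k.+1]. *)
Lemma sweep_stuck t occ reach lev : sweep_inv t occ reach -> t < N ->
  (forall s, s < k -> (occ s != 0) && (lo (nth 0 z t) < hi (occ s).-1)%R) ->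
  ~ solution lo hi F up N k lev.
Proof.
move=> I tN hocc sol.
have h s : s < k -> (occ s).-1 \in take t z.
  by move=> sk; apply: (si_mem I) => //; case/andP: (hocc s sk).
pose ids := nth 0 z t :: [seq (occ s).-1 | s <- iota 0 k].
have bg a : a \in ids -> bag t a.
  rewrite inE => /orP[/eqP->|/mapP[s]].
    by rewrite /bag lohi ?nth_z // take_zS // mem_rcons inE eqxx.
  rewrite mem_iota => /= sk ->; case/andP: (hocc s sk) => _ hs.
  by rewrite /bag hs take_zS // mem_rcons inE h ?orbT.
suff : k < k by rewrite ltnn.
have <- : size ids = k.+1 by rewrite /= size_map size_iota.
apply: (solution_depth sol).
- have inj : {in iota 0 k &, injective (fun s => (occ s).-1)}.
    move=> s s'; rewrite !mem_iota => /= sk sk' e.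
    have /andP[n1 _] := hocc s sk; have /andP[n2 _] := hocc s' sk'.
    by apply: (si_inj I) => //; lia.
  rewrite cons_uniq (map_inj_in_uniq inj) iota_uniq andbT.
  apply/mapP => -[s]; rewrite mem_iota => /= sk e.
  by move: (notin_take_z tN); rewrite e h.
- by apply/allP => a /bg; exact: bag_lt.
- apply/cliqueP => a b /bg ba /bg /andP[_]; apply: le_lt_trans; exact: bag_lo.
Qed.

(** The new segment belongs to no earlier bag, so its level can be changed without touching the
    constraints already checked; the only new constraints are those of bag [t]. *)
Lemma sweep_step t occ reach s occ' (reach' : nat -> bool) :
  sweep_inv t occ reach -> t < N -> s < k ->
  (occ s == 0) || (hi (occ s).-1 <= lo (nth 0 z t))%R ->
  (forall a, a < k -> occ' a = if a == s then (nth 0 z t).+1 else occ a) ->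
  let act a := (occ' a != 0) && (lo (nth 0 z t) < hi (occ' a).-1)%R in
  (forall v, v < k ^ k -> reach' v <->
     (exists v', [/\ v' < k ^ k, reach v' &
        forall a, a < k -> a != s -> digit k a v = digit k a v']) /\
     forall a b c d, a < k -> b < k -> c < k -> d < k ->
       act a -> act b -> act c -> act d ->
       local_ok lo hi F up (occ' a).-1 (occ' b).-1 (occ' c).-1 (occ' d).-1
        (digit k a v) (digit k b v) (digit k c v) (digit k d v)) ->
  sweep_inv t.+1 occ' reach'.
Proof.
move=> I tN sk; set A := nth 0 z t => free hocc' act hreach'.
have occs : occ' s = A.+1 by rewrite hocc' // eqxx.
have occo a : a < k -> a != s -> occ' a = occ a.
  by move=> ak /negbTE ne; rewrite hocc' // ne.
have nA := notin_take_z tN.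
have mem1 a : a < k -> occ' a != 0 -> (occ' a).-1 \in take t.+1 z.
  move=> ak; rewrite hocc' // take_zS // mem_rcons inE.
  case: (a =P s) => /= _ h; first by rewrite eqxx.
  by rewrite (si_mem I) ?orbT.
have placed1 i : i \in take t.+1 z ->
    (exists2 s, s < k & occ' s = i.+1) \/
    (exists2 v, v < t.+1 & (hi i <= lo (nth 0 z v))%R).
  rewrite take_zS // mem_rcons inE => /orP[/eqP->|hi_].
    by left; exists s.
  case: (si_placed I hi_) => [[s' s'k e]|[v vt le]]; last first.
    by right; exists v => //; exact: ltnW.
  case: (eqVneq s' s) => [es|ne]; last by left; exists s' => //; rewrite occo.
  right; exists t => //; move: free; rewrite -es e /=; exact.
have inj1 a b : a < k -> b < k -> occ' a = occ' b -> occ' a != 0 -> a = b.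
  move=> ak bk; rewrite !hocc' //.
  case: (eqVneq a s) => [->|nea]; case: (eqVneq b s) => [->|neb] //.
  - move=> e _; have : A \in take t z by rewrite -[A]/(A.+1.-1) e (si_mem I) // -e.
    by rewrite (negbTE nA).
  - move=> e h; have : A \in take t z by rewrite -[A]/(A.+1.-1) -e (si_mem I).
    by rewrite (negbTE nA).
  - exact: (si_inj I).
(* The new bag is exactly the set of active occupants: a met segment without a slot has ended by
   some left end not after the current one. *)
have bagP i : bag t i <-> exists a, [/\ a < k, act a & (occ' a).-1 = i].
  split=> [/andP[h1 h2]|[a [ak /andP[h1 h2] <-]]]; last by rewrite /bag mem1.
  case: (placed1 i h1) => [[a ak e]|[v vt le]].
    by exists a; rewrite /act e; split.
  have : (lo (nth 0 z v) < lo (nth 0 z v))%R.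
    by apply: lt_le_trans le; apply: le_lt_trans h2; exact: z_le.
  by rewrite ltxx.
have bag_old u i : u < t -> bag u i -> i \in take t z.
  move=> ut b; have iN := bag_lt b; case/andP: b.
  rewrite !mem_take_z //; lia.
split=> // v vq; rewrite hreach' //; split.
  move=> [[v' [v'q rv' hv']] hloc].
  have [lev [l1 l2 l3]] := (iffLR (si_reach I v'q)) rv'.
  pose lev' i := if i == A then digit k s v else lev i.
  have lev'o i : i \in take t z -> lev' i = lev i.
    by rewrite /lev'; case: eqP => // -> h; rewrite h in nA.
  have lev'd a : a < k -> occ' a != 0 -> lev' (occ' a).-1 = digit k a v.
    move=> ak h; case: (eqVneq a s) => [->|ne].
      by rewrite occs /lev' eqxx.
    rewrite occo // lev'o; last by apply: (si_mem I); rewrite -?occo.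
    by rewrite (l3 a) -?occo // hv'.
  exists lev'; split=> //.
  - move=> i; rewrite take_zS // mem_rcons inE => /orP[/eqP->|hi_].
      by rewrite /lev' eqxx digit_lt //; lia.
    by rewrite lev'o // l1.
  - move=> u i j p q; rewrite ltnS leq_eqVlt => /orP[/eqP->|ut].
      move=> /bagP[a [ak aa <-]] /bagP[b [bk ab <-]] /bagP[c [ck ac <-]] /bagP[d [dk ad <-]].
      rewrite /loc !lev'd //; first exact: hloc.
      + by case/andP: ad.
      + by case/andP: ac.
      + by case/andP: ab.
      + by case/andP: aa.
    move=> bi bj bp bq; rewrite /loc !lev'o; try exact: (bag_old u).
    exact: (l2 u).
move=> [lev [l1 l2 l3]].
have lA i : i \in take t z -> lev i < k.
  by move=> h; apply: l1; rewrite take_zS // mem_rcons inE h orbT.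
(* The old word puts back into slot [s] the level that [lev] gives to the evicted segment. *)
have [|v' v'q hv'] := @digits_surj k k (fun a => if a == s then
    if occ s == 0 then 0 else lev (occ s).-1 else digit k a v).
- move=> a ak /=; case: ifP => _; last by rewrite digit_lt //; lia.
  case: ifP => [_|/negbT h]; first lia.
  exact/lA/(si_mem I).
split.
  exists v'; split=> //; last by move=> a ak /negbTE ne; rewrite hv' // ne.
  apply/(si_reach I v'q); exists lev; split=> //.
  - by move=> u i j p q ut; apply: l2; exact: ltnW.
  - move=> a ak h; rewrite hv' //; case: (a =P s) => [e|/eqP ne].
      by rewrite -e (negbTE h).
    by rewrite -(l3 a) ?occo.
move=> a b c d ak bk ck dk aa ab ac ad.
have ba : bag t (occ' a).-1 by apply/bagP; exists a.
have bb : bag t (occ' b).-1 by apply/bagP; exists b.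
have bc : bag t (occ' c).-1 by apply/bagP; exists c.
have bd : bag t (occ' d).-1 by apply/bagP; exists d.
have := l2 t _ _ _ _ (ltnSn t) ba bb bc bd; rewrite /loc.
by case/andP: aa => /(l3 _ ak)-> _; case/andP: ab => /(l3 _ bk)-> _;
  case/andP: ac => /(l3 _ ck)-> _; case/andP: ad => /(l3 _ dk)-> _.
Qed.

End Sweep.

(** * Folded states as local constraints *)

Section Geometry.
Variables (R : realType) (n : nat) (x : n.+2.-tuple R).
Hypothesis strip : paper_strip x.

(** Indexed by [nat] rather than by ordinals, to match the tables in memory and to allow arithmetic
    on indices. *)
Definition seg_lo (i : nat) : R := Num.min (fold_map x i) (fold_map x i.+1).
Definition seg_hi (i : nat) : R := Num.max (fold_map x i) (fold_map x i.+1).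
Definition crease_at (i : nat) : R := fold_map x i.+1.

Lemma seg_bounds i : i <= n ->
  if odd i then seg_lo i = fold_map x i.+1 /\ seg_hi i = fold_map x i
  else seg_lo i = fold_map x i /\ seg_hi i = fold_map x i.+1.
Proof.
move=> le_in; have := strip.2 i le_in; rewrite -subr_gt0 => d0.
have e : fold_map x i.+1 = (fold_map x i + (if odd i then -1 else 1) * (x`_i.+1 - x`_i))%R by [].
rewrite /seg_lo /seg_hi; move: e; case: (odd i) => e.
  have h : (fold_map x i.+1 <= fold_map x i)%R by rewrite e mulN1r gerDl oppr_le0 ltW.
  by split; [exact: min_r | exact: max_l].
have h : (fold_map x i <= fold_map x i.+1)%R by rewrite e mul1r lerDl ltW.
by split; [exact: min_l | exact: max_r].
Qed.

Lemma seg_lo_lt_hi i : i <= n -> (seg_lo i < seg_hi i)%R.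
Proof.
move=> le_in; have := strip.2 i le_in; rewrite -subr_gt0 => d0.
have := seg_bounds le_in; case: ifP => /= h [-> ->]; rewrite h.
  by rewrite mulN1r gtrDl oppr_lt0.
by rewrite mul1r ltrDl.
Qed.

Lemma crease_end i : i < n ->
  if odd i then seg_lo i = crease_at i /\ seg_lo i.+1 = crease_at i
  else seg_hi i = crease_at i /\ seg_hi i.+1 = crease_at i.
Proof.
move=> lt_in; have := seg_bounds (ltnW lt_in); have := seg_bounds lt_in; rewrite [odd _]/=.
by case: (odd i) => /= -[e1 e2] [e3 e4]; rewrite ?e1 ?e2 ?e3 ?e4.
Qed.

Let meets a b := (seg_lo a < seg_hi b)%R && (seg_lo b < seg_hi a)%R.

Let img_loE (A : 'I_n.+1) : img_lo x A = seg_lo A. Proof. by []. Qed.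
Let img_hiE (A : 'I_n.+1) : img_hi x A = seg_hi A. Proof. by []. Qed.

Lemma overlapE (A B : 'I_n.+1) : overlap x A B = meets A B.
Proof.
rewrite /overlap lt_min !gt_max -/(seg_lo A) -/(seg_lo B) -/(seg_hi A) -/(seg_hi B).
by rewrite !seg_lo_lt_hi -1?ltnS //= andbT /meets andbC.
Qed.

Lemma covers_meets (A B : 'I_n.+1) y : covers x A y -> covers x B y -> meets A B.
Proof.
case/andP=> a1 a2 /andP[b1 b2]; rewrite /meets.
by rewrite (lt_trans a1 b2) (lt_trans b1 a2).
Qed.

Lemma crease_meets i : i < n -> meets i i.+1.
Proof.
move=> lt_in; have := crease_end lt_in.
have := seg_lo_lt_hi (ltnW lt_in); have := seg_lo_lt_hi lt_in; rewrite /meets.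
by by case: ifP => _ h1 h2 [e1 e2]; rewrite e1 e2 in h1 h2 *; rewrite h1 h2.
Qed.

(** A segment straddling a crease has points on the side where both joined segments lie, so the
    crossing axiom too concerns a clique. *)
Lemma crossing_meets i a : i < n -> a <= n ->
  (seg_lo a < crease_at i)%R -> (crease_at i < seg_hi a)%R ->
  meets a i /\ meets a i.+1.
Proof.
move=> lt_in le_an h1 h2; have := crease_end lt_in.
have := seg_lo_lt_hi (ltnW lt_in); have := seg_lo_lt_hi lt_in; rewrite /meets.
by case: ifP => _ h3 h4 [e1 e2]; rewrite e1 e2 in h3 h4 *;
  rewrite ?h1 ?h2 ?(lt_trans h1) ?(lt_trans _ h2).
Qed.

Variables (s : n.-tuple crease_letter).

Definition seg_above (i : nat) : bool := goes_above (nth Mountain s i) i.+1.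

(** The rank of a level among the levels in use keeps their order and stays below the height; this
    is the relabelling onto an initial segment of the naturals. *)
Lemma rank_mono (U : seq nat) v w : v \in U ->
  (count (fun u => u < v) U < count (fun u => u < w) U) = (v < w).
Proof.
have le v1 w1 : v1 <= w1 -> count (fun u => u < v1) U <= count (fun u => u < w1) U.
  by move=> h; apply: sub_count => u /=; lia.
move=> vU; apply/idP/idP => [|vw].
  by apply: contraTT; rewrite -!leqNgt; exact: le.
have vn : count (fun u => u < v) U + count (pred1 v) U <= count (fun u => u < w) U.
  rewrite -count_predUI (_ : count (predI _ _) U = 0) ?addn0.
    by apply: sub_count => u /=; case: (u =P v) => [->|_]; lia.
  by rewrite -(count_pred0 U); apply: eq_count => u /=; case: (u =P v) => [->|_]; lia.
by apply: leq_trans vn; rewrite -addn1 leq_add2l -has_count has_pred1.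
Qed.

Lemma rank_lt_size (U : seq nat) v : v \in U -> count (fun u => u < v) U < size U.
Proof.
move=> vU; rewrite -(count_predC (fun u => u < v) U) -[X in X < _]addn0 ltn_add2l.
by rewrite -has_count; apply/hasP; exists v => //=; rewrite ltnn.
Qed.

Lemma seg_beforeE (o : 'I_n) : seg_before o = o :> nat. Proof. by []. Qed.
Lemma seg_afterE (o : 'I_n) : seg_after o = o.+1 :> nat. Proof. by []. Qed.

Let ok lev i j p q := local_ok seg_lo seg_hi crease_at seg_above i j p q
  (lev i) (lev j) (lev p) (lev q).

Lemma leveled_solution k (lev : 'I_n.+1 -> nat) :
  leveled_folded_state x s lev -> height lev <= k ->
  exists lev', solution seg_lo seg_hi crease_at seg_above n.+1 k lev'.
Proof.
move=> [_ dis [_ mv nsc ncc]] hk.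
set U := undup (codom lev).
have memU A : lev A \in U by rewrite mem_undup codom_f.
pose rk i := count (fun u => u < lev (inord i)) U.
have rkE (A : 'I_n.+1) : rk A = count (fun u => u < lev A) U by rewrite /rk inord_val.
have rk_mono (A B : 'I_n.+1) : (rk A < rk B) = (lev A < lev B).
  by rewrite !rkE rank_mono.
exists rk; split=> [i _|].
  by apply: leq_trans hk; exact: rank_lt_size.
move=> i j p q iN jN pN qN /cliqueP cl.
pose I := Ordinal iN; pose J := Ordinal jN; pose P := Ordinal pN; pose Q := Ordinal qN.
have cl_ov (A B : 'I_n.+1) : (A : nat) \in [:: i; j; p; q] ->
    (B : nat) \in [:: i; j; p; q] -> overlap x A B.
  by move=> hA hB; rewrite overlapE /meets !cl.
have lt_rk (A B : 'I_n.+1) : level_order x lev A B -> rk A < rk B.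
  by case/andP => _; rewrite rk_mono.
have rk_lt (A B : 'I_n.+1) : (A : nat) \in [:: i; j; p; q] ->
    (B : nat) \in [:: i; j; p; q] -> rk A < rk B -> level_order x lev A B.
  by move=> hA hB; rewrite rk_mono /level_order cl_ov.
have mi : i \in [:: i; j; p; q] by rewrite !inE eqxx.
have mj : j \in [:: i; j; p; q] by rewrite !inE eqxx orbT.
have mp : p \in [:: i; j; p; q] by rewrite !inE eqxx !orbT.
have mq : q \in [:: i; j; p; q] by rewrite !inE eqxx !orbT.
apply/andP; split.
  apply/implyP => ne; have := dis I J ne (cl_ov I J mi mj).
  by rewrite neq_ltn -!rk_mono -neq_ltn.
apply/implyP => /eqP ej.
have io : i < n by rewrite -ltnS -ej.
pose o := Ordinal io.
have oI : seg_before o = I by apply: val_inj.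
have oJ : seg_after o = J by apply: val_inj; rewrite /= ej.
apply/and3P; split.
- have := mv o; rewrite oI oJ (tnth_nth Mountain) -/(seg_above i).
  by case: ifP => _ /lt_rk.
- apply/implyP => cov; have := nsc o P cov; rewrite oI oJ.
  by case=> -[/lt_rk-> /lt_rk->]; rewrite ?orbT.
apply/implyP => /and3P[/eqP eq ne /eqP eF].
have po : p < n by rewrite -ltnS -eq.
pose o' := Ordinal po.
have oP : seg_before o' = P by apply: val_inj.
have oQ : seg_after o' = Q by apply: val_inj; rewrite /= eq.
have js : joined o :|: joined o' = [set I; J; P; Q].
  by rewrite /joined oI oJ oP oQ !setUA.
(* A crease is a common right end or a common left end of its two segments. If the two creases were
   of different kinds, their segments would lie on opposite sides of the common point, against the
   clique hypothesis. *)
have ss : same_side x (crease_img x o) (joined o :|: joined o').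
  rewrite js /crease_img -/(crease_at i).
  have := crease_end po; have := crease_end io; rewrite -ej -eq -eF.
  case: (odd i) => -[e1 e2]; case: (odd p) => -[e3 e4].
  - by left => A; rewrite !inE -!orbA => /or4P[] /eqP->; rewrite -?e1;
      rewrite img_hiE cl.
  - by have := cl _ _ mi mp; rewrite e1 e3 ltxx.
  - by have := cl _ _ mp mi; rewrite e1 e3 ltxx.
  - by right => A; rewrite !inE -!orbA => /or4P[] /eqP->; rewrite -?e1;
      rewrite img_loE cl.
have nec : o != o' by [].
have H := ncc o o' nec eF ss.
have sIJ : [set I; J] = joined o by rewrite /joined oI oJ.
have sPQ : [set P; Q] = joined o' by rewrite /joined oP oQ.
apply/and4P; split; apply/negP => /and3P[h1 h2 h3].
- by apply: (H I J P Q sIJ sPQ); split; apply: rk_lt.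
- by apply: (H J I P Q _ sPQ); rewrite 1?setUC //; split; apply: rk_lt.
- by apply: (H I J Q P sIJ); rewrite 1?setUC //; split; apply: rk_lt.
- by apply: (H J I Q P); rewrite 1?setUC //; split; apply: rk_lt.
Qed.

Lemma set2_eq (T : finType) (a b c d : T) : a != b ->
  [set c; d] = [set a; b] -> (c = a /\ d = b) \/ (c = b /\ d = a).
Proof.
move=> ne e.
have : a \in [set c; d] by rewrite e !inE eqxx.
have : b \in [set c; d] by rewrite e !inE eqxx orbT.
rewrite !inE => /orP[] /eqP h1 /orP[] /eqP h2; try by [left|right].
- by rewrite h1 h2 eqxx in ne.
- by rewrite h1 h2 eqxx in ne.
Qed.

Lemma solution_leveled k (lev : nat -> nat) :
  solution seg_lo seg_hi crease_at seg_above n.+1 k lev ->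
  exists lev' : 'I_n.+1 -> nat, leveled_folded_state x s lev' /\ height lev' <= k.
Proof.
move=> [lk vld]; exists (fun A => (lev A).+1).
set L := fun A : 'I_n.+1 => (lev A).+1.
have pair_ok (A B : 'I_n.+1) : overlap x A B -> ok lev A B A A.
  rewrite overlapE => /andP[h1 h2]; apply: vld => //.
  have h3 := seg_lo_lt_hi (ltn_ord A); have h4 := seg_lo_lt_hi (ltn_ord B).
  by apply/cliqueP => a b; rewrite !inE => /or4P[] /eqP-> /or4P[] /eqP->.
have dis (A B : 'I_n.+1) : A != B -> overlap x A B -> L A != L B.
  by move=> ne /pair_ok/andP[/implyP/(_ ne)].
have tr_ok (o : 'I_n) (A : 'I_n.+1) :
    meets A o -> meets A o.+1 -> ok lev o o.+1 A A.
  move=> /andP[h1 h2] /andP[h3 h4]; apply: vld; rewrite ?ltn_ord ?ltnS //.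
    exact: ltnW.
  have h5 := seg_lo_lt_hi (ltn_ord A).
  have h6 := seg_lo_lt_hi (ltn_ord o); have h7 := seg_lo_lt_hi (ltnW (ltn_ord o)).
  have /andP[h8 h9] := crease_meets (ltn_ord o).
  by apply/cliqueP => a b; rewrite !inE => /or4P[] /eqP-> /or4P[] /eqP->.
split; last first.
  rewrite /height -[k](size_iota 1); apply: uniq_leq_size; first exact: undup_uniq.
  move=> v; rewrite mem_undup => /codomP[A ->].
  by rewrite mem_iota add1n /= ltnS; apply: lk.
split=> //; split.
- split.
  + by move=> A B /andP[].
  + by move=> y A _; rewrite /level_order ltnn andbF.
  + move=> y A B C cA cB cC /andP[_ h1] /andP[_ h2].
    by rewrite /level_order (ltn_trans h1 h2) overlapE (covers_meets cA cC).
  + move=> y A B cA cB ne.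
    have ov : overlap x A B by rewrite overlapE (covers_meets cA cB).
    have ov' : overlap x B A by rewrite overlapE (covers_meets cB cA).
    by rewrite /level_order ov ov' /= -neq_ltn dis.
- move=> o; have m := crease_meets (ltn_ord o).
  have ov : overlap x (seg_before o) (seg_after o) by rewrite overlapE.
  have ov' : overlap x (seg_after o) (seg_before o).
    by rewrite overlapE; case/andP: m => h1 h2; rewrite /meets h2 h1.
  have := pair_ok _ _ ov; case/andP => _ /implyP/(_ (eqxx _))/and3P[h _ _]; move: h.
  rewrite (tnth_nth Mountain) /seg_above.
  by case: ifP => _ h; rewrite /level_order ?ov ?ov'.
- move=> o A cov; have [h1 h2] := andP cov.
  have [m1 m2] := crossing_meets (ltn_ord o) (ltn_ord A) h1 h2.
  have sw a b : meets a b -> meets b a by move=> /andP[u v]; rewrite /meets u v.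
  have := tr_ok _ _ m1 m2; case/andP => _ /implyP/(_ (eqxx _))/and3P[_ /implyP/(_ cov) h _].
  rewrite /level_order !overlapE m1 m2 (sw _ _ m1) (sw _ _ m2) !ltnS.
  by case/orP: h => /andP[-> ->]; [left | right].
move=> o o' ne eF ss A A' B B' eA eB [l1 l2 l3].
(* Conversely, four segments on the same side of a common end all contain the points close to it on
   that side. *)
have meet4 : clique seg_lo seg_hi [:: o : nat; o.+1; o' : nat; o'.+1].
  have := crease_end (ltn_ord o'); have := crease_end (ltn_ord o).
  have m1 : seg_before o \in joined o :|: joined o' by rewrite !inE eqxx.
  have m2 : seg_after o \in joined o :|: joined o' by rewrite !inE eqxx orbT.
  have m3 : seg_before o' \in joined o :|: joined o' by rewrite !inE eqxx !orbT.
  have m4 : seg_after o' \in joined o :|: joined o' by rewrite !inE eqxx !orbT.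
  have E : crease_at o = crease_at o' by [].
  case: ss => S; have := S _ m1; have := S _ m2; have := S _ m3; have := S _ m4;
    rewrite ?img_hiE ?img_loE /crease_img -/(crease_at o) !seg_beforeE !seg_afterE => s4 s3 s2 s1;
    (case: (odd o) => -[e1 e2]; [|]); (case: (odd o') => -[e3 e4]; [|]);
    move: s1 s2 s3 s4; rewrite ?e1 ?e2 ?e3 ?e4 -?E ?ltxx // => s1 s2 s3 s4;
    apply/cliqueP => a b; rewrite !inE => /or4P[] /eqP-> /or4P[] /eqP->;
    rewrite ?e1 ?e2 ?e3 ?e4 -?E //.
have oN := ltn_ord o; have o'N := ltn_ord o'.
have := vld o o.+1 o' o'.+1 (ltnW oN) oN (ltnW o'N) o'N meet4.
have ne' : (o : nat) != o' by [].
case/andP => _ /implyP/(_ (eqxx _))/and3P[_ _].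
rewrite /crease_at -![fold_map x _.+1]/(crease_img x _) eF !eqxx ne' /= => /and4P[n1 n2 n3 n4].
have nb (p : 'I_n) : seg_before p != seg_after p.
  by apply/eqP => /(congr1 val) /=; rewrite /bump; lia.
move: l1 l2 l3 => /andP[_ l1] /andP[_ l2] /andP[_ l3].
(* The sets determine the two pairs only up to order; each of the four labelings is ruled out by one
   conjunct of [nested]. *)
case: (set2_eq (nb o) eA) => -[? ?]; case: (set2_eq (nb o') eB) => -[? ?]; subst A A' B B';
  rewrite !ltnS !seg_beforeE !seg_afterE in l1 l2 l3.
- by rewrite l1 l2 l3 in n1.
- by rewrite l1 l2 l3 in n3.
- by rewrite l1 l2 l3 in n2.
- by rewrite l1 l2 l3 in n4.
Qed.

End Geometry.

(** * Cursor insertion sort *)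

Section Zipper.
Variables (R : realType) (lo hi F : nat -> R) (up : nat -> bool) (N k : nat).
Hypothesis consec : forall i, i.+1 < N -> (lo i < hi i.+1)%R && (lo i.+1 < hi i)%R.

Let g := starts_within lo hi N.
Let leS := fun a b : nat => (lo a <= lo b)%R.
Let leS_tr : transitive leS. Proof. by move=> a b c; exact: le_trans. Qed.

(** The elements on the wrong side of the cursor, that is, the moves still due before [i] can be
    inserted. *)
Definition pending (i : nat) (l r : seq nat) : nat :=
  count (fun b => lo i < lo b)%R l + count (fun b => lo b < lo i)%R r.

(** Twice the bound on the total of [starts_within], plus one so that credit 0 contradicts it. It is
    left as a sum because the program accumulates it by additions. *)
Definition budget : nat := (\sum_(0 <= j < N) (k + k)).+1.

(* [l] and [r] are the parts of the sorted list on the two sides of the cursor,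
   both with the element nearest to the cursor last. *)
Record zipper_inv (i cred : nat) (l r : seq nat) : Prop := ZipperInv {
  zi_le : i <= N;
  zi_perm : perm_eq (l ++ rev r) (iota 0 i);
  zi_sorted : sorted leS (l ++ rev r);
  zi_credit : budget + (if i < N then pending i l r else 0)
     <= cred + \sum_(0 <= j < minn i N.-1) (g j + g j.+1)
}.

Lemma zipper_inv0 : zipper_inv 0 budget [::] [::].
Proof. by split=> //; rewrite if_same addn0 leq_addr. Qed.

(** A move spends one credit and settles one pending element, so the two sides of [zi_credit] drop
    together. *)
Lemma zipper_left i cred l r a : i < N -> 0 < cred -> (lo i < lo a)%R ->
  zipper_inv i cred (rcons l a) r -> zipper_inv i cred.-1 l (rcons r a).
Proof.
move=> iN c0 la [h1 h2 h3]; rewrite iN /pending -cats1 count_cat /= la => h4.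
have e : l ++ rev (rcons r a) = rcons l a ++ rev r by rewrite rev_rcons cat_rcons.
split; rewrite ?e // iN /pending -cats1 count_cat /= (lt_gtF la); lia.
Qed.

Lemma zipper_right i cred l r a : i < N -> 0 < cred -> (lo a < lo i)%R ->
  zipper_inv i cred l (rcons r a) -> zipper_inv i cred.-1 (rcons l a) r.
Proof.
move=> iN c0 la [h1 h2 h3]; rewrite iN /pending -cats1 count_cat /= la => h4.
have e : rcons l a ++ rev r = l ++ rev (rcons r a) by rewrite rev_rcons cat_rcons.
split; rewrite ?e // iN /pending -cats1 count_cat /= (lt_gtF la); lia.
Qed.

Lemma count_le_starts j (P : pred nat) s : uniq s -> {subset s <= iota 0 N} ->
  (forall b, b \in s -> P b -> (lo j <= lo b)%R && (lo b < hi j)%R) ->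
  count P s <= g j.
Proof.
move=> us sN H; rewrite /g /starts_within -!size_filter.
apply: uniq_leq_size; first exact: filter_uniq.
by move=> b; rewrite !mem_filter => /andP[Pb bs]; rewrite H ?sN.
Qed.

(** After the insertion, the pending elements are those between the left ends of [i] and [i.+1]. As
    the two images overlap at their crease, such left ends lie in the image of whichever of the two
    starts first, so [g i + g i.+1] pays for them. *)
Lemma zipper_push i cred l r : i < N ->
  (forall a, a \in l -> lo a <= lo i)%R -> (forall a, a \in r -> lo i <= lo a)%R ->
  zipper_inv i cred l r -> zipper_inv i.+1 cred (rcons l i) r.
Proof.
move=> iN hl hr [h1 h2 h3 h4].
have mem a : a \in l ++ rev r -> a < i by rewrite (perm_mem h2) mem_iota.
have p' : perm_eq (rcons l i ++ rev r) (iota 0 i.+1).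
  rewrite -addn1 iotaD add0n /= cat_rcons -cat1s perm_catCA.
  by rewrite perm_sym perm_catC /= perm_cons perm_sym.
split=> //.
- move: h3; rewrite cat_rcons !(sorted_pairwise leS_tr) !pairwise_cat /=.
  case/and3P=> a1 -> ->; rewrite allrel_consr a1 !andbT.
  apply/andP; split; apply/allP => a; first exact: hl.
  by rewrite mem_rev; exact: hr.
(* After the last segment there is no further one to travel to, hence the cap [N.-1] on the sum. *)
- case: ifP => [i1N|_]; last first.
    rewrite addn0; apply: leq_trans (leq_trans (leq_addr _ _) h4) _; rewrite leq_add2l.
    have le : minn i N.-1 <= minn i.+1 N.-1 by lia.
    by rewrite [X in _ <= X](big_cat_nat _ le) //= leq_addr.
  have -> : minn i.+1 N.-1 = i.+1 by lia.
  have e1 : minn i N.-1 = i by lia.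
  move: h4; rewrite iN e1 big_nat_recr //=.
  set H := \sum_(0 <= j < i) _ => h4.
  suff : pending i.+1 (rcons l i) r <= g i + g i.+1.
    by move: (g i + g i.+1) (pending _ _ _) (pending _ _ _) h4 => *; lia.
  clear H h4.
  have /andP[k1 k2] := consec i1N.
  have uz : uniq (rcons l i ++ rev r) by rewrite (perm_uniq p') iota_uniq.
  have sz : {subset rcons l i ++ rev r <= iota 0 N}.
    by move=> a; rewrite (perm_mem p') !mem_iota; lia.
  move: uz; rewrite cat_uniq rev_uniq => /and3P[ul _ ur].
  have sl : {subset rcons l i <= iota 0 N}.
    by move=> a h; apply: sz; rewrite mem_cat h.
  have sr : {subset r <= iota 0 N}.
    by move=> a h; apply: sz; rewrite mem_cat mem_rev h orbT.
  have hl' a : a \in rcons l i -> (lo a <= lo i)%R.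
    by rewrite mem_rcons inE => /orP[/eqP->|/hl].
  rewrite /pending; have [le|gt] := leP (lo i) (lo i.+1).
    rewrite (_ : count _ (rcons _ _) = 0); last first.
      apply/eqP; rewrite -leqn0 leqNgt -has_count; apply/hasPn => a /hl' h.
      by rewrite -leNgt (le_trans h).
    rewrite add0n (leq_trans _ (leq_addr _ _)) //.
    apply: count_le_starts => // b /hr -> h; exact: lt_trans k2.
  rewrite (_ : count _ r = 0); last first.
    apply/eqP; rewrite -leqn0 leqNgt -has_count; apply/hasPn => a /hr h.
    by rewrite -leNgt (le_trans (ltW gt)).
  rewrite addn0 (leq_trans _ (leq_addl _ _)) //.
  apply: count_le_starts => // b /hl' h1' h2'; rewrite (ltW h2') /=.
  exact: le_lt_trans k1.
Qed.

(** Each [g j] occurs at most twice in the sum of [zi_credit], so a solution bounds that sum by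
    [2 * k * N], one less than the budget. *)
Lemma zipper_broke i l r lev : zipper_inv i 0 l r -> ~ solution lo hi F up N k lev.
Proof.
move=> [_ _ _ h] /sum_starts_within; rewrite -/g => hg.
have e : \sum_(0 <= j < N) (k + k) = k * N + k * N.
  by rewrite sum_nat_const_nat subn0 mulnDr mulnC.
have : \sum_(0 <= j < minn i N.-1) (g j + g j.+1) <= k * N + k * N.
  have le : minn i N.-1 <= N by lia.
  rewrite big_split /=; apply: leq_add; apply: leq_trans hg.
    by rewrite [X in _ <= X](big_cat_nat _ le) //= leq_addr.
  case: (N) => [|N']; first by rewrite minn0 big_geq.
  have le' : minn i N' <= N' by lia.
  by rewrite /= big_nat_recl // [X in _ <= _ + X](big_cat_nat _ le') //= addnCA leq_addr.
move: h; rewrite /budget e; lia.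
Qed.

End Zipper.

(** * Program logic with running times *)

Fixpoint int_writes (c : cmd) : seq nat :=
  match c with
  | ISet a _ _ => [:: a]
  | Seq c1 c2 | If _ c1 c2 => int_writes c1 ++ int_writes c2
  | While _ c1 => int_writes c1
  | Skip | RSet _ _ _ => [::]
  end.

Fixpoint real_writes (c : cmd) : seq nat :=
  match c with
  | RSet a _ _ => [:: a]
  | Seq c1 c2 | If _ c1 c2 => real_writes c1 ++ real_writes c2
  | While _ c1 => real_writes c1
  | Skip | ISet _ _ _ => [::]
  end.

Definition Var (v : nat) : iexp := IGet v (IConst 0).
Definition SetVar (v : nat) (e : iexp) : cmd := ISet v (IConst 0) e.
Definition BLt (e1 e2 : iexp) : bexp := BNot (BILe e2 e1).
Definition BEq (e1 e2 : iexp) : bexp := BAnd (BILe e1 e2) (BILe e2 e1).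
Definition BRLt (e1 e2 : rexp) : bexp := BNot (BRLe e2 e1).
Definition BREq (e1 e2 : rexp) : bexp := BAnd (BRLe e1 e2) (BRLe e2 e1).
Definition BImp (b1 b2 : bexp) : bexp := BNot (BAnd b1 (BNot b2)).
Definition BOr (b1 b2 : bexp) : bexp := BNot (BAnd (BNot b1) (BNot b2)).

Definition For (v e : nat) (body : cmd) : cmd :=
  Seq (SetVar v (IConst 0))
      (While (BLt (Var v) (Var e))
             (Seq body (SetVar v (IAdd (Var v) (IConst 1))))).

Section Logic.
Variable R : realType.
Implicit Types (m : memory R) (c : cmd).

Lemma beval_lt m e1 e2 : beval m (BLt e1 e2) = (ieval m e1 < ieval m e2).
Proof. by rewrite /= -ltnNge. Qed.
Lemma beval_eq m e1 e2 : beval m (BEq e1 e2) = (ieval m e1 == ieval m e2).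
Proof. by rewrite /= eqn_leq. Qed.
Lemma beval_rlt m e1 e2 : beval m (BRLt e1 e2) = (reval m e1 < reval m e2)%R.
Proof. by rewrite /= -ltNge. Qed.
Lemma beval_req m e1 e2 : beval m (BREq e1 e2) = (reval m e1 == reval m e2).
Proof. by rewrite /= eq_le. Qed.
Lemma beval_imp m b1 b2 : beval m (BImp b1 b2) = (beval m b1 ==> beval m b2).
Proof. by rewrite /=; case: beval; case: beval. Qed.
Lemma beval_or m b1 b2 : beval m (BOr b1 b2) = beval m b1 || beval m b2.
Proof. by rewrite /=; case: beval; case: beval. Qed.
Lemma beval_and m b1 b2 : beval m (BAnd b1 b2) = beval m b1 && beval m b2.
Proof. by []. Qed.
Lemma beval_not m b : beval m (BNot b) = ~~ beval m b.
Proof. by []. Qed.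
Lemma beval_le m e1 e2 : beval m (BILe e1 e2) = (ieval m e1 <= ieval m e2).
Proof. by []. Qed.
Lemma beval_rle m e1 e2 : beval m (BRLe e1 e2) = (reval m e1 <= reval m e2)%R.
Proof. by []. Qed.
Definition bevalE := (beval_lt, beval_eq, beval_rlt, beval_req, beval_imp,
  beval_or, beval_and, beval_not, beval_le, beval_rle).

(** The written arrays are computed from the syntax, so for concrete programs the side conditions of
    a frame are proved by [isT]. *)
Definition frame c m m' : Prop :=
  (forall a, a \notin int_writes c -> ints m' a =1 ints m a) /\
  (forall a, a \notin real_writes c -> reals m' a =1 reals m a).

Lemma frame_refl c m : frame c m m.
Proof. by []. Qed.

Lemma frame_trans c m1 m2 m3 : frame c m1 m2 -> frame c m2 m3 -> frame c m1 m3.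
Proof.
move=> [h1 h2] [h3 h4]; split=> a na i; first by rewrite h3 // h1.
by rewrite h4 // h2.
Qed.

Lemma frame_sub c c' m m' :
  {subset int_writes c <= int_writes c'} -> {subset real_writes c <= real_writes c'} ->
  frame c m m' -> frame c' m m'.
Proof.
move=> s1 s2 [h1 h2]; split=> a na; first by apply: h1; apply: contra na; exact: s1.
by apply: h2; apply: contra na; exact: s2.
Qed.

Lemma exec_frame c m t m' : exec c m t m' -> frame c m m'.
Proof.
elim=> {c m t m'} //.
- by move=> m a e v; split=> b //=; rewrite inE /upd => /negbTE->.
- by move=> m a e v; split=> b //=; rewrite inE /upd => /negbTE->.
- move=> c1 c2 m1 m2 m3 t1 t2 _ h1 _ h2; apply: (@frame_trans _ _ m2).
    by apply: frame_sub h1 => a h; rewrite /= mem_cat h.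
  by apply: frame_sub h2 => a h; rewrite /= mem_cat h orbT.
- move=> b c1 c2 m m' t _; case: beval => h;
    by apply: frame_sub h => a h; rewrite /= mem_cat h ?orbT.
- by move=> b c m1 m2 m3 t1 t2 _ _ h1 _ h2; exact: frame_trans h1 h2.
Qed.

(* [run c m T Q]: from [m], [c] halts within [T] steps in a memory satisfying [Q]. *)
Definition run c m (T : nat) (Q : memory R -> Prop) : Prop :=
  exists t m', [/\ exec c m t m', t <= T & Q m'].

Lemma run_weaken c m T T' (Q Q' : memory R -> Prop) :
  run c m T Q -> (forall m', frame c m m' -> Q m' -> Q' m') -> T <= T' -> run c m T' Q'.
Proof.
move=> [t [m' [ex le q]]] h leT; exists t, m'; split=> //; first exact: leq_trans leT.
exact: h (exec_frame ex) q.
Qed.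

Lemma run_skip m T (Q : memory R -> Prop) : Q m -> 0 < T -> run Skip m T Q.
Proof. by move=> q lt; exists 1, m; split=> //; constructor. Qed.

Lemma run_iset a e v m T (Q : memory R -> Prop) :
  Q (iset m a (ieval m e) (ieval m v)) -> icost e + icost v < T -> run (ISet a e v) m T Q.
Proof. by move=> q lt; eexists _, _; split; [exact: ExecISet | | exact: q]. Qed.

Lemma run_seq c1 c2 m T1 T2 T (Q1 Q : memory R -> Prop) :
  run c1 m T1 Q1 -> (forall m1, frame c1 m m1 -> Q1 m1 -> run c2 m1 T2 Q) ->
  T1 + T2 <= T -> run (Seq c1 c2) m T Q.
Proof.
move=> [t1 [m1 [e1 l1 q1]]] h leT.
have [t2 [m2 [e2 l2 q2]]] := h m1 (exec_frame e1) q1.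
exists (t1 + t2), m2; split=> //; first exact: ExecSeq e1 e2.
by apply: leq_trans leT; exact: leq_add.
Qed.

Lemma run_seq_iset a e v c m T2 T (Q : memory R -> Prop) :
  run c (iset m a (ieval m e) (ieval m v)) T2 Q -> icost e + icost v + T2 < T ->
  run (Seq (ISet a e v) c) m T Q.
Proof.
move=> [t [m' [ex le q]]] lt; eexists _, _; split; [apply: ExecSeq ex; exact: ExecISet | | exact: q].
lia.
Qed.

Lemma run_seq_rset a e v c m T2 T (Q : memory R -> Prop) :
  run c (rset m a (ieval m e) (reval m v)) T2 Q -> icost e + rcost v + T2 < T ->
  run (Seq (RSet a e v) c) m T Q.
Proof.
move=> [t [m' [ex le q]]] lt; eexists _, _; split; [apply: ExecSeq ex; exact: ExecRSet | | exact: q].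
lia.
Qed.

Lemma run_if b c1 c2 m T1 T (Q : memory R -> Prop) :
  (beval m b -> run c1 m T1 Q) -> (~~ beval m b -> run c2 m T1 Q) ->
  bcost b + T1 < T -> run (If b c1 c2) m T Q.
Proof.
move=> h1 h2 lt.
have [t [m' [ex le q]]] : run (if beval m b then c1 else c2) m T1 Q.
  by case: ifP => [/h1|/negbT/h2].
exists (bcost b + t).+1, m'; split=> //; first exact: ExecIf.
by apply: leq_trans lt; rewrite ltnS leq_add2l.
Qed.

(* The index of [I] bounds the number of iterations still to come. *)
Lemma run_while b c (I : nat -> memory R -> Prop) T j m T' (Q : memory R -> Prop) :
  (forall j m1, frame c m m1 -> I j m1 -> beval m1 b ->
    exists2 j', j = j'.+1 & run c m1 T (I j')) ->
  I j m ->
  (forall j' m1, frame c m m1 -> I j' m1 -> ~~ beval m1 b -> Q m1) ->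
  j * (T + bcost b).+1 + (bcost b).+1 <= T' ->
  run (While b c) m T' Q.
Proof.
move=> hI Im hQ; move: j T' (frame_refl c m) Im.
suff gen j m1 T' : frame c m m1 -> I j m1 -> j * (T + bcost b).+1 + (bcost b).+1 <= T' ->
    run (While b c) m1 T' Q by move=> j T'; exact: gen.
elim: j m1 T' => [|j IH] m1 T' fr Im1 le.
  case: (boolP (beval m1 b)) => hb; first by have [j'] := hI _ _ fr Im1 hb.
  eexists _, _; split; [exact: ExecWhileEnd hb | lia | exact: hQ fr Im1 hb].
case: (boolP (beval m1 b)) => hb; last first.
  eexists _, _; split; [exact: ExecWhileEnd hb | lia | exact: hQ fr Im1 hb].
have [_ [<-] [t [m2 [e2 l2 I2]]]] := hI _ _ fr Im1 hb.
have [t3 [m3 [e3 l3 q3]]] := IH m2 _ (frame_trans fr (exec_frame e2)) I2 (leqnn _).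
exists (bcost b + t + t3).+1, m3; split=> //; first exact: ExecWhileStep hb e2 e3.
by move: le; rewrite mulSn; lia.
Qed.

(** The body must establish the invariant for the memory in which the counter is already advanced.
    Of the 13 units per turn, 6 pay the increment and 7 the test and loop step; the final 10 are the
    initialisation (3) and the failing test (7). *)
Lemma run_for v e body (I : nat -> memory R -> Prop) N T m T' (Q : memory R -> Prop) :
  ints m e 0 = N ->
  [&& v != e, v \notin int_writes body & e \notin int_writes body] ->
  I 0 (iset m v 0 0) ->
  (forall j m1, j < N -> frame (For v e body) m m1 -> ints m1 v 0 = j -> I j m1 ->
    run body m1 T (fun m2 => I j.+1 (iset m2 v 0 j.+1))) ->
  (forall m1, frame (For v e body) m m1 -> I N m1 -> Q m1) ->
  N * (T + 13) + 10 <= T' -> run (For v e body) m T' Q.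
Proof.
move=> eN /and3P[ve vb eb] I0 hI hQ le.
set m0 := iset m v 0 0.
set J := fun r (m1 : memory R) => exists j, [/\ j + r = N, ints m1 v 0 = j,
   ints m1 e 0 = N & I j m1].
have fr0 : frame (For v e body) m m0.
  by split=> // a; rewrite inE /m0 /= /upd => /norP[/negbTE->].
have frl m1 : frame (Seq body (SetVar v (IAdd (Var v) (IConst 1)))) m0 m1 ->
    frame (For v e body) m m1.
  move=> h; apply: (frame_trans fr0); apply: frame_sub h => a //=.
  by rewrite inE => ->; rewrite orbT.
have ev : (e == v) = false by rewrite eq_sym (negbTE ve).
apply: (run_seq_iset (T2 := N * (T + 13) + 7)); last by rewrite /=; lia.
apply: (@run_while _ _ J (T + 6) N) => [r m1 /frl fr [j [jr vj eN1 Ij]] hb||j' m1 /frl fr [j [jr vj eN1 Ij]] hb|].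
- have jN : j < N by move: hb; rewrite beval_lt /= vj eN1.
  exists (N - j.+1); first by lia.
  apply: (run_seq (T2 := 6) (hI j m1 jN fr vj Ij)) => [m2 fr2 I2|].
    apply: run_iset => //=; exists j.+1; split; first lia.
    + by rewrite /= /upd !eqxx /= (fr2.1 v vb) vj addn1.
    + by rewrite /= /upd ev /= (fr2.1 e eb).
    + by rewrite /= (fr2.1 v vb) vj addn1.
  by [].
- exists 0; split=> //; first by rewrite /= /upd !eqxx.
  by rewrite /= /upd ev.
- apply: hQ => //; move: hb; rewrite beval_lt /= vj eN1 -leqNgt => h.
  by have <- : j = N by lia.
- by rewrite /=; nia.
Qed.

End Logic.

Arguments BLt : simpl never.
Arguments BEq : simpl never.
Arguments BRLt : simpl never.
Arguments BREq : simpl never.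
Arguments BImp : simpl never.
Arguments BOr : simpl never.

(** * The program *)

(* Names of integer arrays ([v]: only cell 0 is used, as a scalar variable;
   [sz]: size of a stack, bottom at index 0), then of real arrays. *)
Local Notation vK := 3 (only parsing).
Local Notation vN := 4 (only parsing).
Local Notation vI := 5 (only parsing).
Local Notation aPar := 6 (only parsing).
Local Notation vPar := 7 (only parsing).
Local Notation vCred := 8 (only parsing).
Local Notation aL := 9 (only parsing).
Local Notation szL := 10 (only parsing).
Local Notation aR := 11 (only parsing).
Local Notation szR := 12 (only parsing).
Local Notation vFail := 13 (only parsing).
Local Notation vQ := 14 (only parsing).
Local Notation vAcc := 15 (only parsing).
Local Notation vB := 16 (only parsing).
Local Notation vC := 17 (only parsing).
Local Notation rX := 0 (only parsing).
Local Notation rF := 1 (only parsing).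
Local Notation rLo := 2 (only parsing).
Local Notation rHi := 3 (only parsing).

Definition Suc (e : iexp) : iexp := IAdd e (IConst 1).
Definition Pre (e : iexp) : iexp := ISub e (IConst 1).

(** Without multiplication, the alternating sign becomes a choice between [RAdd] and [RSub]; minimum
    and maximum become the choice of which index counts as [first]. *)
Definition Fold (step : rexp -> rexp -> rexp) (first last : iexp) (par : nat) : cmd :=
  Seq (RSet rF (Suc (Var vI))
         (step (RGet rF (Var vI)) (RSub (RGet rX (Suc (Var vI))) (RGet rX (Var vI)))))
  (Seq (RSet rLo (Var vI) (RGet rF first))
  (Seq (RSet rHi (Var vI) (RGet rF last))
       (SetVar vPar (IConst par)))).

Definition Setup : cmd :=
  For vI vN
    (Seq (ISet aPar (Var vI) (Var vPar))
    (Seq (SetVar vCred (IAdd (Var vCred) (IAdd (Var vK) (Var vK))))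
         (If (BILe (Var vPar) (IConst 0))
             (Fold RAdd (Var vI) (Suc (Var vI)) 1)
             (Fold RSub (Suc (Var vI)) (Var vI) 0)))).

Definition Top (a sz : nat) : iexp := IGet a (Pre (Var sz)).
Definition Move (a sa b sb : nat) (rest : cmd) : cmd :=
  Seq (ISet b (Var sb) (Top a sa))
  (Seq (SetVar sb (Suc (Var sb))) (Seq (SetVar sa (Pre (Var sa))) rest)).

(** Since the loop also stops at credit 0, its time is bounded by [N] and the budget on every
    input. *)
Definition Sort : cmd :=
  Seq (SetVar vI (IConst 0))
  (While (BAnd (BLt (Var vI) (Var vN)) (BILe (IConst 1) (Var vCred)))
    (If (BAnd (BILe (IConst 1) (Var szL)) (BRLt (RGet rLo (Var vI)) (RGet rLo (Top aL szL))))
        (Move aL szL aR szR (SetVar vCred (Pre (Var vCred))))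
    (If (BAnd (BILe (IConst 1) (Var szR)) (BRLt (RGet rLo (Top aR szR)) (RGet rLo (Var vI))))
        (Move aR szR aL szL (SetVar vCred (Pre (Var vCred))))
        (Seq (ISet aL (Var szL) (Var vI))
        (Seq (SetVar szL (Suc (Var szL))) (SetVar vI (Suc (Var vI)))))))).

Definition Gather : cmd :=
  While (BILe (IConst 1) (Var szR)) (Move aR szR aL szL Skip).

(** Each multiplication by [k] is a loop of [k] additions. *)
Definition CountWords : cmd :=
  Seq (SetVar vQ (IConst 1))
  (For vB vK
     (Seq (SetVar vAcc (IConst 0))
     (Seq (For vC vK (SetVar vAcc (IAdd (Var vAcc) (Var vQ))))
          (SetVar vQ (Var vAcc))))).

(** * Correctness and cost of the tables, the sort and the word count *)

Section Specs.
Variable R : realType.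
Implicit Types m : memory R.

Record tables (n k : nat) (x : n.+2.-tuple R) (j : nat) m : Prop := Tables {
  tb_cred : ints m vCred 0 = (\sum_(0 <= i < j) (k + k)).+1;
  tb_par : forall i, i < j -> ints m aPar i = odd i;
  tb_fold : forall i, i <= j -> reals m rF i = fold_map x i;
  tb_lo : forall i, i < j -> reals m rLo i = seg_lo x i;
  tb_hi : forall i, i < j -> reals m rHi i = seg_hi x i
}.

Lemma run_setup n k (x : n.+2.-tuple R) m :
  paper_strip x ->
  ints m vK 0 = k -> ints m vN 0 = n.+1 -> ints m vPar 0 = 0 -> ints m vCred 0 = 1 ->
  (forall i, reals m rX i = x`_i)%R -> reals m rF 0 = 0%R ->
  run Setup m (n.+1 * 200 + 10) (tables k x n.+1).
Proof.
move=> strip hK hN hP hC hX hF.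
(* 187 is the rate 200 less the 13 units that [run_for] adds to each turn. *)
apply: (@run_for _ _ _ _ (fun j m => tables k x j m /\ ints m vPar 0 = odd j) n.+1 187) => //.
- split=> //; split=> //=; first by rewrite /upd /= hC big_geq.
  by move=> i; rewrite leqn0 => /eqP->.
- move=> j m1 jn fr vj [[c1 c2 c3 c4 c5] par].
  have K : ints m1 vK 0 = k by rewrite (fr.1 vK isT).
  have X i : (reals m1 rX i = x`_i)%R by rewrite (fr.2 rX isT).
  have bd := seg_bounds strip (jn : j <= n).
  apply: (@run_seq_iset _ _ _ _ _ _ 170); last by [].
  apply: (@run_seq_iset _ _ _ _ _ _ 140); last by [].
  have stepF : fold_map x j.+1 = (fold_map x j + (if odd j then -1 else 1) * (x`_j.+1 - x`_j))%R by [].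
  have F0 := c3 j (leqnn j).
  have neS : (j == j.+1) = false by lia.
  have done_ m2 : ints m2 vCred 0 = ints m1 vCred 0 + (k + k) ->
      (forall i, ints m2 aPar i = if i == j then nat_of_bool (odd j) else ints m1 aPar i) ->
      (forall i, reals m2 rF i = if i == j.+1 then fold_map x j.+1 else reals m1 rF i) ->
      (forall i, reals m2 rLo i = if i == j then seg_lo x j else reals m1 rLo i) ->
      (forall i, reals m2 rHi i = if i == j then seg_hi x j else reals m1 rHi i) ->
      tables k x j.+1 m2.
    move=> e1 e2 e3 e4 e5; split=> [|i|i|i|i].
    - by rewrite e1 c1 big_nat_recr.
    - by rewrite e2 ltnS leq_eqVlt; case: eqP => [-> //|_ /= /c2].
    - by rewrite e3 leq_eqVlt; case: eqP => [-> //|_ /= /c3].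
    - by rewrite e4 ltnS leq_eqVlt; case: eqP => [-> //|_ /= /c4].
    - by rewrite e5 ltnS leq_eqVlt; case: eqP => [-> //|_ /= /c5].
  apply: (run_if (T1 := 100)); last by [].
    rewrite bevalE /= /upd /= par; case oj: (odd j) in bd par stepF * => // _.
    apply: (run_seq_rset (T2 := 70)); last by [].
    apply: (run_seq_rset (T2 := 50)); last by [].
    apply: (run_seq_rset (T2 := 20)); last by [].
    apply: run_iset; last by [].
    split; last by rewrite /= ?oj.
    apply: done_; rewrite /= /upd /= ?K ?vj ?addn1 ?eqxx ?neS ?bd.1 ?bd.2 ?stepF ?oj
      ?mul1r ?F0 ?X ?par //.
  rewrite bevalE /= /upd /= par; case oj: (odd j) in bd par stepF * => // _.
  apply: (run_seq_rset (T2 := 70)); last by [].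
  apply: (run_seq_rset (T2 := 50)); last by [].
  apply: (run_seq_rset (T2 := 20)); last by [].
  apply: run_iset; last by [].
  split; last by rewrite /= ?oj.
  apply: done_; rewrite /= /upd /= ?K ?vj ?addn1 ?eqxx ?neS ?bd.1 ?bd.2 ?stepF ?oj
    ?mulN1r ?F0 ?X ?par //.
- by move=> m1 _ [].
Qed.

Definition stack m a sz : seq nat := mkseq (ints m a) (ints m sz 0).

Lemma mkseq_upd (f g : nat -> nat) s v :
  (forall i, g i = if i == s then v else f i) -> mkseq g s.+1 = rcons (mkseq f s) v.
Proof.
move=> H; rewrite mkseqS H eqxx; congr rcons.
by apply/eq_in_map => i; rewrite mem_iota H => /andP[_]; case: eqP => // ->; rewrite ltnn.
Qed.

Lemma run_move a sa b sb rest m s T T' Q :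
  ints m sa 0 = s.+1 -> uniq [:: a; sa; b; sb] ->
  (forall m', stack m a sa = rcons (stack m' a sa) (ints m a s) ->
     stack m' b sb = rcons (stack m b sb) (ints m a s) ->
     frame (Move a sa b sb Skip) m m' -> run rest m' T Q) ->
  T + 30 <= T' -> run (Move a sa b sb rest) m T' Q.
Proof.
move=> es; rewrite /= !inE !negb_or !andbT => /and3P[/and3P[n1 n2 n3] /andP[n4 n5] n6] H le.
apply: (run_seq_iset (T2 := T + 20)); last by rewrite /=; lia.
apply: (run_seq_iset (T2 := T + 10)); last by rewrite /=; lia.
apply: (run_seq_iset (T2 := T)); last by rewrite /=; lia.
have [[e1 e2 e3] [e4 e5 e6]] : [/\ (a == sa) = false, (a == b) = false & (a == sb) = false] /\
  [/\ (sa == b) = false, (sa == sb) = false & (b == sb) = false].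
  by split; split; apply: negbTE.
have E := (eqxx, e1, e2, e3, e4, e5, e6, eq_sym sa a, eq_sym b a, eq_sym sb a,
  eq_sym b sa, eq_sym sb sa, eq_sym sb b).
set m' := iset _ sa _ _.
have a1 : ints m' sa 0 = s by rewrite /m' /= /upd /= !E /= es subn1.
have a2 : ints m' sb 0 = (ints m sb 0).+1 by rewrite /m' /= /upd /= !E /= addn1.
have a3 : ints m' a =1 ints m a by move=> i; rewrite /m' /= /upd /= !E.
have a4 i : ints m' b i = if i == ints m sb 0 then ints m a s else ints m b i.
  by rewrite /m' /= /upd /= !E /= es subn1.
apply: H; rewrite /stack.
- by rewrite a1 es mkseqS; congr rcons; apply: eq_mkseq => i; rewrite a3.
- by rewrite a2; exact: mkseq_upd.
- split=> c //=; rewrite !inE !negb_or => /and3P[/negbTE h1 /negbTE h2 /negbTE h3] i.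
  by rewrite /upd h1 h2 h3.
Qed.

Section Sorting.
Variables (lo hi : nat -> R) (N k : nat).
Hypothesis consec : forall i, i.+1 < N -> (lo i < hi i.+1)%R && (lo i.+1 < hi i)%R.

Let leS_tr : transitive (fun a b : nat => lo a <= lo b)%R.
Proof. by move=> a b c; exact: le_trans. Qed.

Lemma size_stack m a sz : size (stack m a sz) = ints m sz 0.
Proof. by rewrite size_mkseq. Qed.

(** Both stacks are monotone away from the cursor, so testing their two tops is enough. *)
Lemma stack_top_le i cred m1 :
  zipper_inv lo hi N k i cred (stack m1 aL szL) (stack m1 aR szR) ->
  ((0 < ints m1 szL 0)%N -> lo (ints m1 aL (ints m1 szL 0).-1) <= lo i)%R ->
  ((0 < ints m1 szR 0)%N -> lo i <= lo (ints m1 aR (ints m1 szR 0).-1))%R ->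
  (forall a, a \in stack m1 aL szL -> lo a <= lo i)%R /\
  (forall a, a \in stack m1 aR szR -> lo i <= lo a)%R.
Proof.
move=> [_ _ so _]; move: so; rewrite (sorted_pairwise leS_tr) pairwise_cat.
rewrite /stack => /and3P[_ sl sr] hl hr; split=> a.
  case: (ints m1 szL 0) sl hl => // s; rewrite mkseqS pairwise_rcons => /andP[/allP h _] hl.
  by rewrite mem_rcons inE => /orP[/eqP->|/h /le_trans ->] //; exact: hl.
case: (ints m1 szR 0) sr hr => // s; rewrite mkseqS rev_rcons => /andP[/allP h _] hr.
rewrite mem_rcons inE => /orP[/eqP->|ha]; first exact: hr.
by apply: le_trans (hr isT) _; apply: h; rewrite mem_rev.
Qed.

Lemma run_sort m :
  ints m vN 0 = N -> ints m vCred 0 = budget N k -> ints m szL 0 = 0 -> ints m szR 0 = 0 ->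
  reals m rLo =1 lo ->
  run Sort m ((N + budget N k) * 200 + 100)
    (fun m1 => exists i, zipper_inv lo hi N k i (ints m1 vCred 0) (stack m1 aL szL) (stack m1 aR szR)
       /\ (0 < ints m1 vCred 0 -> i = N)).
Proof.
move=> hN hC hL hR hlo.
apply: (run_seq_iset (T2 := (N + budget N k) * 200 + 50)); last by rewrite /=; lia.
(* Every turn lowers this measure by one: a move spends credit, an insertion advances [i]. *)
pose I r m1 := exists i, [/\ ints m1 vI 0 = i, r = N - i + ints m1 vCred 0 &
   zipper_inv lo hi N k i (ints m1 vCred 0) (stack m1 aL szL) (stack m1 aR szR)].
apply: (@run_while _ _ _ I 150 (N + budget N k)).
- move=> r m1 fr [i [vi er zi]].
  have N1 : ints m1 vN 0 = N by rewrite (fr.1 vN isT).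
  have lo1 : reals m1 rLo =1 lo by move=> a; rewrite (fr.2 rLo isT) /= hlo.
  rewrite bevalE beval_lt beval_le /= N1 vi => /andP[iN c0].
  exists r.-1; first lia.
  apply: (run_if (T1 := 100)); last by [].
    rewrite bevalE beval_le beval_rlt /= vi !lo1 subn1 => /andP[l0 lt].
    case el: (ints m1 szL 0) l0 lt => [//|sl] _ lt.
    apply: (run_move (T := 50) el); [by []| |by []] => m2 sL sR fm.
    have iE : ints m2 vI 0 = i by rewrite (fm.1 vI isT).
    have cE : ints m2 vCred 0 = ints m1 vCred 0 by rewrite (fm.1 vCred isT).
    apply: run_iset => //=; exists i; rewrite /= /upd /= cE subn1; split=> //; first lia.
    rewrite sL in zi; have := zipper_left iN c0 lt zi; rewrite -sR; exact.
  rewrite bevalE beval_le beval_rlt /= vi !lo1 subn1 => topL.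
  apply: (run_if (T1 := 70)); last by [].
    rewrite bevalE beval_le beval_rlt /= vi !lo1 subn1 => /andP[l0 lt].
    case el: (ints m1 szR 0) l0 lt => [//|sl] _ lt.
    apply: (run_move (T := 40) el); [by []| |by []] => m2 sR sL fm.
    have iE : ints m2 vI 0 = i by rewrite (fm.1 vI isT).
    have cE : ints m2 vCred 0 = ints m1 vCred 0 by rewrite (fm.1 vCred isT).
    apply: run_iset => //=; exists i; rewrite /= /upd /= cE subn1; split=> //; first lia.
    rewrite sR in zi; have := zipper_right iN c0 lt zi; rewrite -sL; exact.
  rewrite bevalE beval_le beval_rlt /= vi !lo1 subn1 => topR.
  apply: (run_seq_iset (T2 := 50)); last by [].
  apply: (run_seq_iset (T2 := 30)); last by [].
  apply: run_iset; last by [].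
  have [hl hr] : (forall a, a \in stack m1 aL szL -> lo a <= lo i)%R /\
      (forall a, a \in stack m1 aR szR -> lo i <= lo a)%R.
    apply: stack_top_le zi _ _ => s0; first by move: topL; rewrite s0 /= -leNgt.
    by move: topR; rewrite s0 /= -leNgt.
  exists i.+1; rewrite /= /upd /= vi addn1; split=> //; first lia.
  have := zipper_push consec iN hl hr zi.
  rewrite /stack /= /upd /= addn1.
  by rewrite (@mkseq_upd (ints m1 aL) _ _ i).
- exists 0; rewrite /= /upd /= hC; split=> //; first by rewrite subn0.
  rewrite /stack /= /upd /= hL hR; exact: zipper_inv0.
- move=> _ m1 fr [i [vi _ zi]]; rewrite bevalE beval_lt beval_le /= vi => g.
  exists i; split=> // c0; move: g; rewrite c0 andbT -leqNgt (fr.1 vN isT) /= /upd /= hN.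
  by have := zi_le zi; lia.
- by rewrite (_ : bcost _ = 11) //; move: (N + _) => K; lia.
Qed.

Lemma run_gather m :
  run Gather m (ints m szR 0 * 40 + 10)
    (fun m1 => stack m1 aL szL = stack m aL szL ++ rev (stack m aR szR)).
Proof.
pose I r m1 := ints m1 szR 0 = r /\
  stack m1 aL szL ++ rev (stack m1 aR szR) = stack m aL szL ++ rev (stack m aR szR).
apply: (@run_while _ _ _ I 35 (ints m szR 0)) => //.
- move=> r m1 _ [er es]; rewrite bevalE /= er; case: r er => // r er _.
  exists r => //.
  apply: (run_move (T := 5) er) => // m2 sR sL fm; apply: run_skip => //; split.
    by have := congr1 size sR; rewrite size_rcons !size_stack er => -[].
  by rewrite -es sR sL rev_rcons cat_rcons.
- move=> r m1 _ [er <-]; rewrite bevalE /= -ltnNge ltnS leqn0 => /eqP e.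
  by rewrite /stack e cats0.
- by rewrite (_ : bcost _ = 4) //; lia.
Qed.
End Sorting.

Lemma run_count_words k m : ints m vK 0 = k ->
  run CountWords m (k * (k * 20 + 40) + 20) (fun m1 => ints m1 vQ 0 = k ^ k).
Proof.
move=> hK; apply: (run_seq_iset (T2 := k * (k * 20 + 40) + 10)); last by rewrite /=; lia.
apply: (@run_for _ _ _ _ (fun j m1 => ints m1 vQ 0 = k ^ j) k (k * 20 + 20)) => //=; last nia.
move=> j m1 jk fr _ hQ.
have K1 : ints m1 vK 0 = k by rewrite (fr.1 vK isT).
apply: (run_seq_iset (T2 := k * 20 + 15)); last by rewrite /=; lia.
apply: (run_seq (T1 := k * 20 + 10) (T2 := 4) (Q1 := fun m2 => ints m2 vAcc 0 = k * k ^ j));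
  [|by move=> m2 _ e; apply: run_iset => //=; rewrite /upd /= e expnS|lia].
apply: (@run_for _ _ _ _ (fun i m2 => ints m2 vAcc 0 = i * k ^ j) k 7) => //=.
move=> i m2 ik fr2 _ hA; apply: run_iset => //=.
by rewrite /upd /= hA (fr2.1 vQ isT) /= /upd /= hQ mulSn addnC.
Qed.
End Specs.

(** * The dynamic program as code *)

Local Notation vT := 18 (only parsing).
Local Notation vA := 19 (only parsing).
Local Notation vS := 20 (only parsing).
Local Notation aOcc := 21 (only parsing).
Local Notation aAct := 22 (only parsing).
Local Notation vTau := 23 (only parsing).
Local Notation aW := 24 (only parsing).
Local Notation vSig := 25 (only parsing).
Local Notation aW' := 26 (only parsing).
Local Notation vRem := 27 (only parsing).
Local Notation vQuo := 28 (only parsing).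
Local Notation vE := 29 (only parsing).
Local Notation vOk := 30 (only parsing).
Local Notation aRe := 31 (only parsing).
Local Notation aRe' := 32 (only parsing).
Local Notation va := 33 (only parsing).
Local Notation vb := 34 (only parsing).
Local Notation vc := 35 (only parsing).
Local Notation vd := 36 (only parsing).

(** Division by repeated subtraction would not end for [k = 0], but the outer loop is then empty. *)
Definition Decode (src dst : nat) : cmd :=
  Seq (SetVar vRem (Var src))
  (For va vK
    (Seq (SetVar vQuo (IConst 0))
    (Seq (While (BILe (Var vK) (Var vRem))
                (Seq (SetVar vRem (ISub (Var vRem) (Var vK))) (SetVar vQuo (Suc (Var vQuo)))))
    (Seq (ISet dst (Var va) (Var vRem)) (SetVar vRem (Var vQuo)))))).

(* Is there a reached word that agrees with word [vTau] off the slot [vS]?  The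
   level of the segment previously in that slot is forgotten. *)
Definition Project : cmd :=
  Seq (SetVar vOk (IConst 0))
  (For vSig vQ
    (If (BILe (IConst 1) (IGet aRe (Var vSig)))
        (Seq (Decode vSig aW')
        (Seq (SetVar vE (IConst 1))
        (Seq (For vb vK
                (If (BOr (BEq (Var vb) (Var vS)) (BEq (IGet aW (Var vb)) (IGet aW' (Var vb))))
                    Skip (SetVar vE (IConst 0))))
             (If (BILe (IConst 1) (Var vE)) (SetVar vOk (IConst 1)) Skip))))
        Skip)).

Definition Active (v : nat) : bexp := BILe (IConst 1) (IGet aAct (Var v)).
(** A slot holds its segment plus one. For the segment [i] this is also the index of the crease at
    its far end, both in the letter array and in the table of the folding map. *)
Definition Occ (v : nat) : iexp := IGet aOcc (Var v).
Definition Lev (v : nat) : iexp := IGet aW (Var v).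
Definition Crease (v : nat) : rexp := RGet rF (Occ v).

Definition Between (e1 e2 e3 e4 : iexp) : bexp :=
  BNot (BAnd (BLt e1 e2) (BAnd (BLt e2 e3) (BLt e3 e4))).

(** Follows [local_ok] conjunct by conjunct. The mountain-valley test is a comparison of bits:
    [S_{i+1}] goes above [S_i] exactly when the code of the letter of [p_{i+1}] differs from the
    parity of [i]. *)
Definition Local : bexp :=
  BAnd (BImp (BNot (BEq (Occ va) (Occ vb))) (BNot (BEq (Lev va) (Lev vb))))
  (BImp (BEq (Occ vb) (Suc (Occ va)))
    (BAnd (BOr (BAnd (BNot (BEq (IGet 1 (Occ va)) (IGet aPar (Pre (Occ va))))) (BLt (Lev va) (Lev vb)))
               (BAnd (BEq (IGet 1 (Occ va)) (IGet aPar (Pre (Occ va)))) (BLt (Lev vb) (Lev va))))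
    (BAnd (BImp (BAnd (BRLt (RGet rLo (Pre (Occ vc))) (Crease va))
                      (BRLt (Crease va) (RGet rHi (Pre (Occ vc)))))
                (BOr (BAnd (BLt (Lev vc) (Lev va)) (BLt (Lev vc) (Lev vb)))
                     (BAnd (BLt (Lev va) (Lev vc)) (BLt (Lev vb) (Lev vc)))))
          (BImp (BAnd (BEq (Occ vd) (Suc (Occ vc)))
                (BAnd (BNot (BEq (Occ va) (Occ vc))) (BREq (Crease va) (Crease vc))))
                (BAnd (Between (Lev va) (Lev vc) (Lev vb) (Lev vd))
                (BAnd (Between (Lev vb) (Lev vc) (Lev va) (Lev vd))
                (BAnd (Between (Lev va) (Lev vd) (Lev vb) (Lev vc))
                      (Between (Lev vb) (Lev vd) (Lev va) (Lev vc))))))))).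

Definition Check4 : bexp :=
  BImp (BAnd (Active va) (BAnd (Active vb) (BAnd (Active vc) (Active vd)))) Local.

Definition Check : cmd :=
  For va vK (For vb vK (For vc vK (For vd vK
    (If Check4 Skip (SetVar vOk (IConst 0)))))).

Definition Filter : cmd :=
  Seq (Decode vTau aW)
  (Seq Project
  (Seq Check (ISet aRe' (Var vTau) (Var vOk)))).

(* [vS] = k encodes that no slot is free. *)
Definition Slots : cmd :=
  Seq (SetVar vS (Var vK))
  (For va vK
    (If (BOr (BILe (Occ va) (IConst 0)) (BRLe (RGet rHi (Pre (Occ va))) (RGet rLo (Var vA))))
        (Seq (ISet aAct (Var va) (IConst 0)) (SetVar vS (Var va)))
        (ISet aAct (Var va) (IConst 1)))).

(** The new family goes to a second array because [Project] still reads the old one for every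
    word. *)
Definition Update : cmd :=
  Seq (For vTau vQ Filter)
      (For vTau vQ (ISet aRe (Var vTau) (IGet aRe' (Var vTau)))).

Definition Step : cmd :=
  Seq (SetVar vA (IGet aL (Var vT)))
  (Seq Slots
  (If (BLt (Var vS) (Var vK))
      (Seq (ISet aOcc (Var vS) (Suc (Var vA)))
      (Seq (ISet aAct (Var vS) (IConst 1)) Update))
      (SetVar vFail (IConst 1)))).

Definition Sweep : cmd :=
  Seq (For vTau vQ (ISet aRe (Var vTau) (IConst 1)))
      (For vT vN (If (BILe (Var vFail) (IConst 0)) Step Skip)).

Definition Report : cmd :=
  For vTau vQ
    (If (BAnd (BILe (Var vFail) (IConst 0)) (BILe (IConst 1) (IGet aRe (Var vTau))))
        (ISet 2 (IConst 0) (IConst 1)) Skip).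

(** * Correctness and cost of one sweep step *)

Section Specs.
Variables (R : realType) (k : nat).
Implicit Types m : memory R.
Let q := k ^ k.

Lemma word_count_gt0 : 0 < q.
Proof. by rewrite /q; case: k => // k'; rewrite expn_gt0. Qed.

Lemma width_le_count : k <= q.
Proof.
rewrite /q; case: k => [//|[//|k']].
by rewrite -[X in X <= _]expn1 leq_pexp2l.
Qed.

(** A loop of at most [q] turns raises the exponent by one; 23 collects the 13 and the 10 of
    [run_for]. *)
Lemma loop_cost j T A e : j <= q -> T <= A * q ^ e -> j * (T + 13) + 10 <= (A + 23) * q ^ e.+1.
Proof.
move=> jq le; have q0 := word_count_gt0; have : 0 < q ^ e by rewrite expn_gt0 q0.
rewrite expnS; move: (q ^ e) le => x le x0.
apply: (@leq_trans (q * (A * x + 13) + 10)); first by rewrite leq_add2r leq_mul // leq_add2r.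
by rewrite mulnDl mulnDr (mulnCA q); have : 0 < q * x by [rewrite muln_gt0 q0]; nia.
Qed.

(** Listing the two pairs of names in use lets every disequality between arrays be settled by
    computation. *)
Lemma run_decode src dst m :
  (src = vTau /\ dst = aW) \/ (src = vSig /\ dst = aW') ->
  ints m vK 0 = k -> ints m src 0 < q ->
  run (Decode src dst) m (100 * q ^ 2)
    (fun m1 => forall a, a < k -> ints m1 dst a = digit k a (ints m src 0)).
Proof.
move=> cs hK; set w := ints m src 0 => wq.
have q0 := word_count_gt0; have kq := width_le_count.
apply: (run_seq_iset (T2 := k * (19 * q + 33) + 10)); last first.
  by rewrite /=; nia.
apply: (@run_for _ _ _ _ (fun j m1 => ints m1 vRem 0 = w %/ k ^ j /\
    forall a, a < j -> ints m1 dst a = digit k a w) k (19 * q + 20)) => //.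
- by case: cs => -[? ?]; subst.
- by split=> //; rewrite /= /upd /= divn1; case: cs => -[? ?]; subst.
- move=> j m1 jk fr vj [rem digs].
  have K1 : ints m1 vK 0 = k by rewrite (fr.1 vK) //; case: cs => -[? ?]; subst.
  apply: (run_seq_iset (T2 := 19 * q + 16)); last by rewrite /=; lia.
  apply: (run_seq (T1 := 19 * q + 6) (T2 := 10)
     (Q1 := fun m2 => ints m2 vRem 0 = (w %/ k ^ j) %% k /\ ints m2 vQuo 0 = (w %/ k ^ j) %/ k)).
  + pose I r m2 := ints m2 vRem 0 + ints m2 vQuo 0 * k = w %/ k ^ j /\ ints m2 vRem 0 <= r.
    apply: (@run_while _ _ _ I 13 (w %/ k ^ j)).
    * move=> r m2 fr2 [e er]; rewrite bevalE /= (fr2.1 vK isT) /= /upd /= K1 => le.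
      exists r.-1; first lia.
      apply: (run_seq_iset (T2 := 6)) => //; apply: run_iset => //.
      split; rewrite /= /upd /= (fr2.1 vK isT) /= /upd /= K1; last lia.
      by rewrite -e addn1 mulSn addnA subnK.
    * by split; rewrite /= /upd /= rem // mul0n addn0.
    * move=> r m2 fr2 [e _]; rewrite bevalE /= (fr2.1 vK isT) /= /upd /= K1 -ltnNge => lt.
      have k0 : 0 < k by lia.
      by rewrite -e addnC modnMDl modn_small // divnMDl // divn_small // addn0.
    * have : w %/ k ^ j <= q by apply: leq_trans (leq_div _ _) (ltnW wq).
      by rewrite (_ : bcost _ = 5) //; lia.
  + move=> m2 fr2 [e1 e2].
    have V : ints m2 va 0 = j by rewrite (fr2.1 va isT).
    have D a : ints m2 dst a = ints m1 dst a.
      by rewrite (fr2.1 dst) //; case: cs => -[? ?]; subst.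
    have nd : (vRem == dst) = false /\ (va == dst) = false /\ (dst == va) = false /\
       (vQuo == dst) = false /\ (dst == vRem) = false.
      by case: cs => -[? ?]; subst.
    apply: (run_seq_iset (T2 := 4)) => //; apply: run_iset => //.
    have [n1 [n2 [n3 [n4 n5]]]] := nd.
    rewrite /= /upd /= ?n1 ?n2 ?n3 ?n4 ?n5 /= e2; split; first by rewrite expnSr divnMA.
    move=> a; rewrite V eqxx ltnS leq_eqVlt /=; case: (a =P j) => [-> _|_ /= aj].
      by rewrite e1.
    by rewrite D digs.
  + lia.
- by move=> m1 _ [].
- by rewrite -addnA.
Qed.

Definition reached m (v : nat) : bool := 0 < ints m aRe v.

Lemma iotaS_all (P : pred nat) j : all P (iota 0 j.+1) = all P (iota 0 j) && P j.
Proof. by rewrite -addn1 iotaD all_cat /= andbT. Qed.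

Lemma iotaS_has (P : pred nat) j : has P (iota 0 j.+1) = has P (iota 0 j) || P j.
Proof. by rewrite -addn1 iotaD has_cat /= orbF. Qed.

Definition projects m (s w : nat) : bool :=
  has (fun v => reached m v && all (fun a => (a == s) || (digit k a w == digit k a v)) (iota 0 k))
    (iota 0 q).

Lemma run_project m w :
  ints m vK 0 = k -> ints m vQ 0 = q -> (forall a, a < k -> ints m aW a = digit k a w) ->
  run Project m (1000 * q ^ 3)
    (fun m1 => (0 < ints m1 vOk 0) = projects m (ints m vS 0) w).
Proof.
move=> hK hQ hW; set s := ints m vS 0.
have q0 := word_count_gt0; have kq := width_le_count.
apply: (run_seq_iset (T2 := q * (100 * q ^ 2 + k * 100 + 100) + 10)); last first.
  by rewrite /= !expnS expn0; nia.
apply: (@run_for _ _ _ _ (fun j m1 => (0 < ints m1 vOk 0) =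
    has (fun v => reached m v && all (fun a => (a == s) || (digit k a w == digit k a v)) (iota 0 k))
    (iota 0 j)) q (100 * q ^ 2 + k * 100 + 80)) => //; last by lia.
move=> j m1 jq fr vj ok.
have K1 : ints m1 vK 0 = k by rewrite (fr.1 vK isT).
have S1 : ints m1 vS 0 = s by rewrite (fr.1 vS isT).
have R1 : reached m j = (0 < ints m1 aRe j) by rewrite (fr.1 aRe isT).
have W1 a : a < k -> ints m1 aW a = digit k a w by move=> ak; rewrite (fr.1 aW isT) /= /upd /= hW.
rewrite iotaS_has R1.
apply: (run_if (T1 := 100 * q ^ 2 + k * 100 + 70)); last by rewrite (_ : bcost _ = 5) //; lia.
  rewrite bevalE /= vj => re.
  have dec : run (Decode vSig aW') m1 (100 * q ^ 2)
     (fun m2 => forall a, a < k -> ints m2 aW' a = digit k a j).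
    by have := @run_decode vSig aW' m1 (or_intror (conj erefl erefl)) K1; rewrite vj; apply.
  apply: (run_seq dec (T2 := k * 100 + 60)); last lia.
  move=> m2 fr2 dig.
  have E2 a : a < k -> ((a == ints m2 vS 0) || (ints m2 aW a == ints m2 aW' a)) =
     ((a == s) || (digit k a w == digit k a j)).
    by move=> ak; rewrite (fr2.1 vS isT) S1 (fr2.1 aW isT) W1 // dig.
  have K2 : ints m2 vK 0 = k by rewrite (fr2.1 vK isT).
  have O2 : ints m2 vOk 0 = ints m1 vOk 0 by rewrite (fr2.1 vOk isT).
  apply: (run_seq_iset (T2 := k * 100 + 50)); last by rewrite /=; lia.
  apply: (run_seq (T1 := k * 100 + 10) (T2 := 30) (Q1 := fun m3 => (0 < ints m3 vE 0) =
     all (fun a => (a == s) || (digit k a w == digit k a j)) (iota 0 k))); last lia.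
    apply: (@run_for _ _ _ _ (fun i m3 => (0 < ints m3 vE 0) =
       all (fun a => (a == s) || (digit k a w == digit k a j)) (iota 0 i)) k 60) => //; last lia.
    move=> i m3 ik fr3 vi ok3.
    rewrite iotaS_all -E2 // -ok3.
    have M := (fr3.1 vS isT, fr3.1 aW isT, fr3.1 aW' isT).
    apply: (run_if (T1 := 10)) => //; rewrite !bevalE /= vi !M.
      by move=> ->; apply: run_skip; rewrite //= andbT.
    by move=> /negbTE->; apply: run_iset => //; rewrite /= /upd /= andbF.
  move=> m3 fr3 e3.
  have O3 : ints m3 vOk 0 = ints m1 vOk 0 by rewrite (fr3.1 vOk isT) /= /upd /= O2.
  rewrite re /= -e3 -ok -O3.
  apply: (run_if (T1 := 10)) => //; rewrite bevalE /= => h.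
    by apply: run_iset => //; rewrite /= /upd /= h orbT.
  by apply: run_skip => //; rewrite (negbTE h) orbF.
rewrite bevalE /= vj => /negbTE->; apply: run_skip; last lia.
by rewrite /= orbF -ok.
Qed.


Definition mem_above m (i : nat) : bool := ints m 1 i.+1 != ints m aPar i.

Definition mem_local m (lev : nat -> nat) (a b c d : nat) : bool :=
  local_ok (reals m rLo) (reals m rHi) (fun i => reals m rF i.+1) (mem_above m)
    (ints m aOcc a).-1 (ints m aOcc b).-1 (ints m aOcc c).-1 (ints m aOcc d).-1
    (lev a) (lev b) (lev c) (lev d).

Definition active m (a : nat) : bool := 0 < ints m aAct a.

Definition mem_check m (lev : nat -> nat) (a b c d : nat) : bool :=
  [&& active m a, active m b, active m c & active m d] ==> mem_local m lev a b c d.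

(** Active slots are assumed occupied since truncated subtraction undoes the shift by one only on
    positive values. *)
Lemma beval_check4 m :
  (forall v, v \in [:: va; vb; vc; vd] ->
     active m (ints m v 0) -> 0 < ints m aOcc (ints m v 0)) ->
  beval m Check4 = mem_check m (ints m aW) (ints m va 0) (ints m vb 0) (ints m vc 0) (ints m vd 0).
Proof.
move=> H; rewrite /Check4 /mem_check beval_imp.
rewrite -[beval m (BAnd _ _)]/[&& active m (ints m va 0), active m (ints m vb 0),
  active m (ints m vc 0) & active m (ints m vd 0)].
set L := beval m Local.
case: (boolP (active m (ints m va 0))) => //= aa.
case: (boolP (active m (ints m vb 0))) => //= ab.
case: (boolP (active m (ints m vc 0))) => //= ac.
case: (boolP (active m (ints m vd 0))) => //= ad.
have := H va isT aa; have := H vb isT ab; have := H vc isT ac; have := H vd isT ad.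
rewrite /L /mem_local /local_ok /Local /nested /Between /Crease /Lev /Occ !bevalE /= /mem_above.
case: (ints m aOcc (ints m va 0)) => // oa; case: (ints m aOcc (ints m vb 0)) => // ob.
case: (ints m aOcc (ints m vc 0)) => // oc; case: (ints m aOcc (ints m vd 0)) => // od.
move=> _ _ _ _; rewrite !subn1 !addn1 /= !eqSS.
case: (ints m 1 oa.+1 == ints m aPar oa); rewrite /= ?orbF //.
Qed.

Lemma frame_subb c c' m m' :
  all [in int_writes c'] (int_writes c) && all [in real_writes c'] (real_writes c) ->
  frame c m m' -> frame c' m m'.
Proof. by case/andP => /allP s1 /allP s2; exact: frame_sub. Qed.

Lemma mem_check_frame m m1 lev a b c d :
  frame Check m m1 -> mem_check m1 lev a b c d = mem_check m lev a b c d.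
Proof.
move=> fr; have E := (fr.1 1 isT, fr.1 aPar isT, fr.1 aOcc isT, fr.1 aAct isT,
  fr.2 rLo isT, fr.2 rHi isT, fr.2 rF isT).
by rewrite /mem_check /mem_local /active /local_ok /mem_above !E.
Qed.

(** The flag [vOk] is only ever lowered, so nested loops compose as conjunctions. *)
Lemma run_all v body (P : nat -> bool) T m T' :
  v != vOk -> [&& v != vK, v \notin int_writes body & vK \notin int_writes body] ->
  ints m vK 0 = k ->
  (forall j m1, j < k -> frame (For v vK body) m m1 -> ints m1 v 0 = j ->
     run body m1 T (fun m2 => (0 < ints m2 vOk 0) = (0 < ints m1 vOk 0) && P j)) ->
  k * (T + 13) + 10 <= T' ->
  run (For v vK body) m T' (fun m1 => (0 < ints m1 vOk 0) = (0 < ints m vOk 0) && all P (iota 0 k)).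
Proof.
rewrite eq_sym => /negbTE nv cond hK H le.
apply: (@run_for _ _ _ _ (fun j m1 =>
  (0 < ints m1 vOk 0) = (0 < ints m vOk 0) && all P (iota 0 j)) k T) => //.
  by rewrite /= andbT /upd nv.
move=> j m1 jk fr vj ok; apply: run_weaken (H j m1 jk fr vj) _ (leqnn T) => m2 _ e.
by rewrite iotaS_all /= /upd nv /= e ok andbA.
Qed.

Definition all4 (P : nat -> nat -> nat -> nat -> bool) : bool :=
  all (fun a => all (fun b => all (fun c => all (fun d => P a b c d)
    (iota 0 k)) (iota 0 k)) (iota 0 k)) (iota 0 k).

Lemma run_check m :
  ints m vK 0 = k -> (forall a, a < k -> active m a -> 0 < ints m aOcc a) ->
  run Check m ((bcost Check4 + 150) * q ^ 4)
    (fun m1 => (0 < ints m1 vOk 0) = (0 < ints m vOk 0) && all4 (mem_check m (ints m aW))).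
Proof.
move=> hK hA; have q0 := word_count_gt0; have kq := width_le_count.
set D := bcost Check4.
pose T3 := k * (D + 30) + 10; pose T2 := k * (T3 + 13) + 10; pose T1 := k * (T2 + 13) + 10.
have KE m1 : frame Check m m1 -> ints m1 vK 0 = k by move=> fr; rewrite (fr.1 vK isT).
apply: (run_all (T := T1)) => //; last first.
  (* Three enclosing loops add 23 each to the 40 of the innermost one, and 109 is below 150. *)
  have b3 : T3 <= (D + 40) * q ^ 1 by rewrite /T3 expn1; nia.
  apply: leq_trans (loop_cost kq (loop_cost kq (loop_cost kq b3))) _.
  by rewrite leq_mul2r -!addnA leq_add2l orbT.
move=> a m1 ak fr1' vA; have fr1 : frame Check m m1 by exact: fr1'.
apply: (run_all (T := T2)) => //; first exact: KE.
move=> b m2 bk fr2' vB.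
have fr2 : frame Check m m2 by apply: (frame_trans fr1); apply: frame_subb fr2'.
have a2 : ints m2 va 0 = a by rewrite (fr2'.1 va isT).
apply: (run_all (T := T3)) => //; first exact: KE.
move=> c m3 ck fr3' vC.
have fr3 : frame Check m m3 by apply: (frame_trans fr2); apply: frame_subb fr3'.
have a3 : ints m3 va 0 = a by rewrite (fr3'.1 va isT).
have b3 : ints m3 vb 0 = b by rewrite (fr3'.1 vb isT).
apply: (run_all (T := D + 15)) => //; first exact: KE; last by rewrite /T3; lia.
move=> d m4 dk fr4' vD.
have fr4 : frame Check m m4 by apply: (frame_trans fr3); apply: frame_subb fr4'.
have a4 : ints m4 va 0 = a by rewrite (fr4'.1 va isT).
have b4 : ints m4 vb 0 = b by rewrite (fr4'.1 vb isT).
have c4 : ints m4 vc 0 = c by rewrite (fr4'.1 vc isT).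
have ce : beval m4 Check4 = mem_check m (ints m aW) a b c d.
  rewrite beval_check4 => [|v].
    rewrite a4 b4 c4 vD -(mem_check_frame _ _ _ _ _ fr4) /mem_check /mem_local.
    by rewrite !(fr4.1 aW isT).
  rewrite /active !(fr4.1 aAct isT) !(fr4.1 aOcc isT).
  by rewrite !inE => /or4P[] /eqP->; rewrite ?a4 ?b4 ?c4 ?vD; apply: hA.
apply: (run_if (T1 := 5)); rewrite ?ce -/D; last lia.
  by move=> ->; apply: run_skip; rewrite ?andbT.
by move=> /negbTE->; apply: run_iset => //; rewrite /= /upd /= andbF.
Qed.


Lemma projects_eq m m1 s w : ints m1 aRe =1 ints m aRe -> projects m1 s w = projects m s w.
Proof. by move=> e; apply: eq_has => v; rewrite /reached e. Qed.

Lemma all4_eq (P P' : nat -> nat -> nat -> nat -> bool) :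
  (forall a b c d, a < k -> b < k -> c < k -> d < k -> P a b c d = P' a b c d) ->
  all4 P = all4 P'.
Proof.
move=> H; apply: eq_in_all => a; rewrite mem_iota => /= ak.
apply: eq_in_all => b; rewrite mem_iota => /= bk.
apply: eq_in_all => c; rewrite mem_iota => /= ck.
by apply: eq_in_all => d; rewrite mem_iota => /= dk; exact: H.
Qed.

Lemma all4P P a b c d : all4 P -> a < k -> b < k -> c < k -> d < k -> P a b c d.
Proof.
have mem i : i < k -> i \in iota 0 k by rewrite mem_iota.
move=> H ak bk ck dk.
by move/allP/(_ _ (mem _ ak))/allP/(_ _ (mem _ bk))/allP/(_ _ (mem _ ck))/allP: H; apply; exact: mem.
Qed.

Lemma all4I (P : nat -> nat -> nat -> nat -> bool) :
  (forall a b c d, a < k -> b < k -> c < k -> d < k -> P a b c d) -> all4 P.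
Proof.
move=> H; apply/allP => a; rewrite mem_iota => /= ak; apply/allP => b; rewrite mem_iota => /= bk.
apply/allP => c; rewrite mem_iota => /= ck; apply/allP => d; rewrite mem_iota => /= dk.
exact: H.
Qed.

Lemma mem_check_eq m m1 lev lev1 a b c d :
  (forall i, i \in [:: 1; aPar; aOcc; aAct] -> ints m1 i =1 ints m i) ->
  (forall i, reals m1 i =1 reals m i) ->
  lev1 a = lev a -> lev1 b = lev b -> lev1 c = lev c -> lev1 d = lev d ->
  mem_check m1 lev1 a b c d = mem_check m lev a b c d.
Proof.
move=> H Hr ea eb ec ed.
have E := (H 1 isT, H aPar isT, H aOcc isT, H aAct isT, Hr, ea, eb, ec, ed).
by rewrite /mem_check /mem_local /active /local_ok /mem_above !E.
Qed.

Definition survives m (v : nat) : bool :=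
  projects m (ints m vS 0) v && all4 (mem_check m (fun a => digit k a v)).

Lemma survives_frame m m1 v :
  (forall i, i \in [:: 1; aPar; aOcc; aAct] -> ints m1 i =1 ints m i) ->
  (forall i, reals m1 i =1 reals m i) ->
  ints m1 aRe =1 ints m aRe -> ints m1 vS =1 ints m vS ->
  survives m1 v = survives m v.
Proof.
move=> H Hr eR eS; rewrite /survives (projects_eq _ _ eR) eS; congr andb.
by apply: all4_eq => *; apply: mem_check_eq.
Qed.

Lemma four_arrays m m1 c :
  [&& 1 \notin int_writes c, aPar \notin int_writes c, aOcc \notin int_writes c
    & aAct \notin int_writes c] -> frame c m m1 ->
  forall i, i \in [:: 1; aPar; aOcc; aAct] -> ints m1 i =1 ints m i.
Proof.
by case/and4P=> h1 h2 h3 h4 fr i; rewrite !inE => /or4P[] /eqP->; exact: fr.1.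
Qed.

Lemma run_filter m w :
  ints m vK 0 = k -> ints m vQ 0 = q -> ints m vTau 0 = w -> w < q ->
  (forall a, a < k -> active m a -> 0 < ints m aOcc a) ->
  run Filter m ((bcost Check4 + 1300) * q ^ 4)
    (fun m1 => forall v, (0 < ints m1 aRe' v) =
       if v == w then survives m w else 0 < ints m aRe' v).
Proof.
move=> hK hQ hw wq hA; set D := bcost Check4; have q0 := word_count_gt0.
have [q2 q3] : q ^ 2 <= q ^ 4 /\ q ^ 3 <= q ^ 4 by rewrite !leq_pexp2l.
have q4 : 0 < q ^ 4 by rewrite expn_gt0 q0.
have dec := @run_decode vTau aW m (or_introl (conj erefl erefl)) hK; rewrite hw in dec.
apply: (run_seq (dec wq) (T2 := (D + 1200) * q ^ 4)); last by nia.
move=> m1 fr1 W1.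
have K1 : ints m1 vK 0 = k by rewrite (fr1.1 vK isT).
have Q1 : ints m1 vQ 0 = q by rewrite (fr1.1 vQ isT).
apply: (run_seq (run_project K1 Q1 W1) (T2 := (D + 200) * q ^ 4)); last by nia.
move=> m2 fr2 P2.
have K2 : ints m2 vK 0 = k by rewrite (fr2.1 vK isT).
have A2 a : a < k -> active m2 a -> 0 < ints m2 aOcc a.
  by move=> ak; rewrite /active (fr2.1 aAct isT) (fr1.1 aAct isT) (fr2.1 aOcc isT) (fr1.1 aOcc isT); apply: hA.
apply: (run_seq (run_check K2 A2) (T2 := 10)); last by nia.
move=> m3 fr3 C3; apply: run_iset => //= v.
have V3 : ints m3 vTau 0 = w by rewrite (fr3.1 vTau isT) (fr2.1 vTau isT) (fr1.1 vTau isT).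
rewrite /upd /= V3; case: eqP => _; last first.
  by rewrite (fr3.1 aRe' isT) (fr2.1 aRe' isT) (fr1.1 aRe' isT).
rewrite C3 P2 /survives (fr1.1 vS isT) (projects_eq _ _ (fr1.1 aRe isT)); congr andb.
apply: all4_eq => a b c d ak bk ck dk; apply: mem_check_eq.
- move=> i hi x; rewrite (@four_arrays _ _ Project isT fr2) //.
  by rewrite (@four_arrays _ _ (Decode vTau aW) isT fr1).
- by move=> i x; rewrite fr2.2 // fr1.2.
all: by rewrite (fr2.1 aW isT) W1.
Qed.

(** Four powers of [q] cover the quadruple loop of [Check], the fifth the range of words; this
    dominates the cost of a step. *)
Lemma run_update m :
  ints m vK 0 = k -> ints m vQ 0 = q ->
  (forall a, a < k -> active m a -> 0 < ints m aOcc a) ->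
  run Update m ((bcost Check4 + 1400) * q ^ 5)
    (fun m1 => forall v, v < q -> reached m1 v = survives m v).
Proof.
move=> hK hQ hA; set D := bcost Check4; have q0 := word_count_gt0.
have q1 : q <= q ^ 5 by rewrite -[X in X <= _]expn1 leq_pexp2l.
apply: (run_seq (T1 := (D + 1323) * q ^ 5) (T2 := q * 23 + 10)
  (Q1 := fun m1 => forall v, v < q -> (0 < ints m1 aRe' v) = survives m v)); last by nia.
  apply: (@run_for _ _ _ _ (fun j m1 => forall v, v < j -> (0 < ints m1 aRe' v) = survives m v)
    q ((D + 1300) * q ^ 4)) => //.
    move=> j m1 jq fr vj H.
    have K1 : ints m1 vK 0 = k by rewrite (fr.1 vK isT).
    have Q1 : ints m1 vQ 0 = q by rewrite (fr.1 vQ isT).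
    have A1 a : a < k -> active m1 a -> 0 < ints m1 aOcc a.
      by move=> ak; rewrite /active (fr.1 aAct isT) (fr.1 aOcc isT); apply: hA.
    apply: run_weaken (run_filter K1 Q1 vj jq A1) _ (leqnn _) => m2 _ H2 v.
    rewrite ltnS leq_eqVlt /= /upd /= H2; case: (v =P j) => [-> _|_ /= /H //].
    apply: survives_frame; try exact: fr.1.
      exact: (@four_arrays _ _ (For vTau vQ Filter) isT fr).
    by move=> i; exact: fr.2.
  by apply: leq_trans (loop_cost (leqnn q) (leqnn _)) _; rewrite leq_mul2r -addnA leqnn orbT.
move=> m1 fr1 H1.
apply: (@run_for _ _ _ _ (fun j m2 => forall v, v < j -> reached m2 v = survives m v) q 10) => //.
  by rewrite (fr1.1 vQ isT).
move=> j m2 jq fr vj H; apply: run_iset => //= v.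
rewrite ltnS leq_eqVlt /reached /= /upd /= vj; case: (v =P j) => [-> _|_ /= /H //].
by rewrite (fr.1 aRe' isT) /= /upd /= H1.
Qed.

Definition free m (a : nat) : bool :=
  (ints m aOcc a == 0) || (reals m rHi (ints m aOcc a).-1 <= reals m rLo (ints m vA 0))%R.

Lemma run_slots m : ints m vK 0 = k ->
  run Slots m (k * 100 + 100)
    (fun m1 => (forall a, a < k -> ints m1 aAct a = ~~ free m a) /\
       ((ints m1 vS 0 = k /\ forall a, a < k -> ~~ free m a) \/
        (ints m1 vS 0 < k /\ free m (ints m1 vS 0)))).
Proof.
move=> hK; apply: (run_seq_iset (T2 := k * 100 + 50)); last by rewrite /=; lia.
apply: (@run_for _ _ _ _ (fun j m1 => (forall a, a < j -> ints m1 aAct a = ~~ free m a) /\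
       ((ints m1 vS 0 = k /\ forall a, a < j -> ~~ free m a) \/
        (ints m1 vS 0 < k /\ free m (ints m1 vS 0)))) k 80) => //; last lia.
  by split=> //; left.
move=> j m1 jk fr vj [H1 H2].
have fE : beval m1 (BOr (BILe (Occ va) (IConst 0))
     (BRLe (RGet rHi (Pre (Occ va))) (RGet rLo (Var vA)))) = free m j.
  rewrite !bevalE /= vj leqn0 subn1 (fr.1 aOcc isT) (fr.1 vA isT) (fr.2 rHi isT) (fr.2 rLo isT).
  by [].
apply: (run_if (T1 := 30)) => //; rewrite fE => fj.
  apply: (run_seq_iset (T2 := 10)) => //; apply: run_iset => //=.
  rewrite /upd /= vj; split; last by right.
  move=> a; rewrite ltnS leq_eqVlt; case: (a =P j) => [->|_ /= /H1 //].
  by rewrite fj.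
apply: run_iset => //=; rewrite /upd /= vj; split.
  move=> a; rewrite ltnS leq_eqVlt; case: (a =P j) => [->|_ /= /H1 //].
  by rewrite fj.
case: H2 => [[-> h]|h]; [left; split=> // a|by right].
by rewrite ltnS leq_eqVlt => /orP[/eqP->|/h].
Qed.

Section Sweeping.
Variables (lo hi F : nat -> R) (up : nat -> bool) (N : nat) (z : seq nat).
Hypothesis lohi : forall i, i < N -> (lo i < hi i)%R.
Hypothesis zperm : perm_eq z (iota 0 N).
Hypothesis zsorted : sorted (fun a b => lo a <= lo b)%R z.

Record env m : Prop := Env {
  en_k : ints m vK 0 = k;
  en_q : ints m vQ 0 = q;
  en_n : ints m vN 0 = N;
  en_lo : reals m rLo =1 lo;
  en_hi : reals m rHi =1 hi;
  en_f : forall i, reals m rF i.+1 = F i;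
  en_up : mem_above m =1 up;
  en_z : forall t, t < N -> ints m aL t = nth 0 z t
}.

Lemma env_frame c m m1 :
  all [predC int_writes c] [:: 1; vK; vN; aPar; aL; vQ] && (real_writes c == [::]) ->
  frame c m m1 -> env m -> env m1.
Proof.
case/andP=> /and5P[h1 h2 h3 h4 /and3P[h5 h6 _]] /eqP rw fr [e1 e2 e3 e4 e5 e6 e7 e8].
have r i : reals m1 i =1 reals m i by apply: fr.2; rewrite rw.
split.
- by rewrite (fr.1 vK).
- by rewrite (fr.1 vQ).
- by rewrite (fr.1 vN).
- by move=> i; rewrite r.
- by move=> i; rewrite r.
- by move=> i; rewrite r.
- by move=> i; rewrite -e7 /mem_above (fr.1 1) // (fr.1 aPar).
- by move=> t tN; rewrite (fr.1 aL) // e8.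
Qed.

Lemma mem_localE m lev a b c d : env m -> mem_local m lev a b c d =
  local_ok lo hi F up (ints m aOcc a).-1 (ints m aOcc b).-1 (ints m aOcc c).-1
    (ints m aOcc d).-1 (lev a) (lev b) (lev c) (lev d).
Proof.
by move=> en; rewrite /mem_local /local_ok !(en_up en) !(en_lo en) !(en_hi en) !(en_f en).
Qed.

Definition sweep_state (t : nat) m : Prop :=
  (0 < ints m vFail 0 /\ forall lev, ~ solution lo hi F up N k lev) \/
  (ints m vFail 0 = 0 /\ sweep_inv lo hi F up k z t (ints m aOcc) (reached m)).

Lemma run_step t m : t < N -> env m -> ints m vT 0 = t -> ints m vFail 0 = 0 ->
  sweep_inv lo hi F up k z t (ints m aOcc) (reached m) ->
  run Step m ((bcost Check4 + 2000) * q ^ 5) (sweep_state t.+1).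
Proof.
move=> tN en vT0 fail0 inv; set D := bcost Check4.
have q0 := word_count_gt0; have kq := width_le_count.
have q1 : q <= q ^ 5 by rewrite -[X in X <= _]expn1 leq_pexp2l.
apply: (run_seq_iset (T2 := (D + 1900) * q ^ 5)); last by rewrite /=; nia.
set m1 := iset m _ _ _.
have A1 : ints m1 vA 0 = nth 0 z t by rewrite /m1 /= /upd /= vT0 (en_z en).
have K1 : ints m1 vK 0 = k by exact: en_k en.
apply: (run_seq (run_slots K1) (T2 := (D + 1600) * q ^ 5)); last by nia.
move=> m2 fr2 [act2 S2].
have freeE a : free m1 a = (ints m aOcc a == 0) || (hi (ints m aOcc a).-1 <= lo (nth 0 z t))%R.
  by rewrite /free A1 /= /upd /= (en_hi en) (en_lo en).
have K2 : ints m2 vK 0 = k by rewrite (fr2.1 vK isT).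
apply: (run_if (T1 := (D + 1500) * q ^ 5)); last by rewrite (_ : bcost _ = 6) //; nia.
  rewrite bevalE /= K2 => Sk.
  have fS : free m1 (ints m2 vS 0) by case: S2 => [[e]|[//]]; rewrite e ltnn in Sk.
  set s := ints m2 vS 0 in Sk fS S2.
  apply: (run_seq_iset (T2 := (D + 1450) * q ^ 5)); last by rewrite /=; nia.
  apply: (run_seq_iset (T2 := (D + 1400) * q ^ 5)); last by rewrite /=; nia.
  set m3 := iset _ aAct _ _.
  have fr3 : frame Step m m3.
    split=> i ni x; last by rewrite /m3 /= fr2.2.
    rewrite /m3 /= /upd.
    have -> : (i == aAct) = false by apply/negbTE; apply: contra ni => /eqP->.
    have -> /= : (i == aOcc) = false by apply/negbTE; apply: contra ni => /eqP->.
    rewrite fr2.1; last first.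
      by apply: contra ni; apply/allP: i.
    rewrite /m1 /= /upd.
    by have -> /= : (i == vA) = false by apply/negbTE; apply: contra ni => /eqP->.
  have en3 : env m3 by exact: (env_frame (c := Step)) fr3 en.
  have occ3 a : ints m3 aOcc a = if a == s then (nth 0 z t).+1 else ints m aOcc a.
    by rewrite /m3 /= /upd /= -/s (fr2.1 vA isT) A1 addn1 (fr2.1 aOcc isT).
  (* [Slots] marked the chosen slot inactive because it was free. The later write to [aAct] corrects
     this for the new segment, which reaches past its own left end by [lohi]. *)
  have act3 a : a < k -> active m3 a =
      (ints m3 aOcc a != 0) && (lo (nth 0 z t) < hi (ints m3 aOcc a).-1)%R.
    move=> ak; rewrite occ3 /active /m3 /= /upd /= -/s.
    case: (a =P s) => _ /=; first by rewrite lohi // -(mem_z zperm) mem_nth ?(size_z zperm).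
    by rewrite act2 // freeE negb_or -ltNge; case: (_ && _).
  have occ_act a : a < k -> active m3 a -> 0 < ints m3 aOcc a.
    by move=> ak; rewrite act3 // lt0n => /andP[].
  have S3 : ints m3 vS 0 = s by [].
  apply: run_weaken (run_update (en_k en3) (en_q en3) occ_act) _ (leqnn _) => m4 fr4 H4.
  right; split.
    by rewrite (fr4.1 vFail isT) -[ints m3 _ _]/(ints m2 vFail 0) (fr2.1 vFail isT).
  have O4 : ints m4 aOcc =1 ints m3 aOcc by exact: (fr4.1 aOcc isT).
  apply: (sweep_step zperm zsorted inv tN Sk); first by rewrite -freeE.
    by move=> a ak; rewrite O4 occ3.
  move=> v vq; have R4 : reached m4 v = survives m3 v by exact: H4.
  have R3 w : reached m3 w = reached m w by rewrite /reached /m3 /= /upd /= (fr2.1 aRe isT).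
  have chk a b c d : a < k -> b < k -> c < k -> d < k ->
      mem_check m3 (fun a => digit k a v) a b c d =
      [&& active m3 a, active m3 b, active m3 c & active m3 d] ==>
      local_ok lo hi F up (ints m4 aOcc a).-1 (ints m4 aOcc b).-1 (ints m4 aOcc c).-1
        (ints m4 aOcc d).-1 (digit k a v) (digit k b v) (digit k c v) (digit k d v).
    by move=> *; rewrite !O4 /mem_check (mem_localE _ _ _ _ _ en3).
  rewrite R4 /survives /projects S3; split=> [/andP[/hasP[w]]|[[w [wq rw agree]] loc]].
    rewrite mem_iota R3 => /= wq /andP[rw /allP agree] loc; split.
      exists w; split=> // a ak /negbTE ne.
      by have := agree a; rewrite mem_iota ne => /(_ ak)/eqP.
    move=> a b c d ak bk ck dk; rewrite !O4 -!act3 // => aa ab ac ad.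
    have := all4P loc ak bk ck dk; rewrite chk // aa ab ac ad !O4; exact.
  apply/andP; split.
    apply/hasP; exists w; first by rewrite mem_iota.
    rewrite R3 rw; apply/allP => a; rewrite mem_iota => /= ak.
    by case: (a =P s) => //= /eqP ne; rewrite agree.
  apply: all4I => a b c d ak bk ck dk; rewrite chk //.
  apply/implyP => /and4P[aa ab ac ad].
  by apply: loc; rewrite ?O4 -?act3.
rewrite bevalE /= K2 => Sk; apply: run_iset; last by rewrite /=; nia.
left; split=> // lev; apply: (sweep_stuck lohi zperm zsorted inv tN) => s sk.
case: S2 => [[_ h]|[lt]]; last by rewrite lt in Sk.
by have := h s sk; rewrite freeE negb_or -ltNge.
Qed.
End Sweeping.
End Specs.

(** Needed because the tables in memory are known to agree with the strip only on its segments, and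
    for [up] only on its creases. *)
Lemma solution_ext (R : realType) (lo hi F lo' hi' F' : nat -> R) up up' N k lev :
  (forall i, i < N -> [/\ lo i = lo' i, hi i = hi' i & F i = F' i]) ->
  (forall i, i.+1 < N -> up i = up' i) ->
  solution lo hi F up N k lev -> solution lo' hi' F' up' N k lev.
Proof.
move=> E U [h1 h2]; split=> // i j p q iN jN pN qN cl.
have [l1 r1 f1] := E _ iN; have [l2 r2 f2] := E _ jN.
have [l3 r3 f3] := E _ pN; have [l4 r4 f4] := E _ qN.
have := h2 i j p q iN jN pN qN; rewrite /local_ok -l3 -r3 -f1 -f3.
case: (j =P i.+1) => [ej|_]; first rewrite -U ?ej -?ej //; apply;
  by move: cl; rewrite /clique /= -l1 -l2 -l3 -l4 -r1 -r2 -r3 -r4.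
Qed.

(** With all slots empty no digit is constrained, so the initial family must contain every word. *)
Lemma sweep_inv_start (R : realType) (lo hi F : nat -> R) up k z occ (reach : nat -> bool) :
  (forall a, occ a = 0) -> (forall v, v < k ^ k -> reach v) ->
  sweep_inv lo hi F up k z 0 occ reach.
Proof.
move=> occ0 r1; split=> [s _|i|s s' _ _ _|v vq]; rewrite ?occ0 ?take0 //.
split=> _; last exact: r1.
by exists id; split=> [i|//|s _]; rewrite ?take0 ?occ0.
Qed.

(** * The sweep over all segments and the report *)

Section Specs.
Variables (R : realType) (k : nat).
Implicit Types m : memory R.
Let q := k ^ k.
Let D := bcost Check4.

Lemma run_reset m : ints m vQ 0 = q ->
  run (For vTau vQ (ISet aRe (Var vTau) (IConst 1))) m (q * 30 + 10)
    (fun m1 => forall v, v < q -> reached m1 v).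
Proof.
move=> hQ; apply: (@run_for _ _ _ _ (fun j m1 => forall v, v < j -> reached m1 v) q 10) => //.
  move=> j m1 jq fr vj H; apply: run_iset => //= v.
  by rewrite ltnS leq_eqVlt /reached /= /upd /= vj; case: (v =P j) => [//|_ /= /H].
by rewrite leq_add2r leq_mul2l orbT.
Qed.

Definition sweep_cost (N : nat) : nat := q * 30 + N * ((D + 2100) * q ^ 5) + 30.

Lemma run_sweep_failed m N :
  ints m vQ 0 = q -> ints m vN 0 = N -> 0 < ints m vFail 0 ->
  run Sweep m (sweep_cost N) (fun m1 => 0 < ints m1 vFail 0).
Proof.
move=> hQ hN hF; have q0 := word_count_gt0 k.
have q5 : 0 < q ^ 5 by rewrite expn_gt0 q0.
apply: (run_seq (run_reset hQ) (T2 := N * ((D + 2100) * q ^ 5) + 10)); last by rewrite /sweep_cost; lia.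
move=> m1 fr1 _; apply: (@run_for _ _ _ _ (fun _ m2 => 0 < ints m2 vFail 0) N 20) => //.
- by rewrite (fr1.1 vN isT).
- by rewrite /= /upd /= (fr1.1 vFail isT).
- move=> j m2 jN fr vj f; apply: (run_if (T1 := 5)) => //; rewrite bevalE /= leqNgt.
    by rewrite f.
  by move=> _; exact: run_skip.
- by rewrite leq_add2r leq_mul2l; apply/orP; right; nia.
Qed.

Lemma run_sweep (lo hi F : nat -> R) up N z m :
  (forall i, i < N -> (lo i < hi i)%R) -> perm_eq z (iota 0 N) ->
  sorted (fun a b => lo a <= lo b)%R z -> env k lo hi F up N z m ->
  (forall a, ints m aOcc a = 0) -> ints m vFail 0 = 0 ->
  run Sweep m (sweep_cost N) (sweep_state k lo hi F up N z N).
Proof.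
move=> lohi zperm zsorted en occ0 fail0; have q0 := word_count_gt0 k.
have q5 : 0 < q ^ 5 by rewrite expn_gt0 q0.
apply: (run_seq (run_reset (en_q en)) (T2 := N * ((D + 2100) * q ^ 5) + 10));
  last by rewrite /sweep_cost; lia.
move=> m1 fr1 re1.
have en1 : env k lo hi F up N z m1 by exact: env_frame fr1 en.
apply: (@run_for _ _ _ _ (fun t m2 => sweep_state k lo hi F up N z t m2) N
  ((D + 2050) * q ^ 5)) => //.
- exact: en_n en1.
- right; split; first by rewrite /= /upd /= (fr1.1 vFail isT).
  by apply: sweep_inv_start => // a; rewrite /= /upd /= (fr1.1 aOcc isT).
- move=> t m2 tN fr2 vt2 st.
  have en2 : env k lo hi F up N z m2 by exact: env_frame fr2 en1.
  case: st => [[f no]|[f inv]].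
    apply: (run_if (T1 := 5)); last by rewrite (_ : bcost _ = 4) //; nia.
      by rewrite bevalE /= leqNgt f.
    by move=> _; apply: run_skip => //; left.
  apply: (run_if (T1 := (D + 2000) * q ^ 5)); last by rewrite (_ : bcost _ = 4) //; nia.
    by move=> _; exact: (run_step lohi zperm zsorted tN en2 vt2 f inv).
  by rewrite bevalE /= f.
- by rewrite leq_add2r leq_mul2l; apply/orP; right; nia.
Qed.

Lemma run_report m : ints m vQ 0 = q -> ints m 2 0 = 0 ->
  run Report m (q * 50 + 10)
    (fun m1 => answers_yes m1 = (ints m vFail 0 == 0) && has (reached m) (iota 0 q)).
Proof.
move=> hQ h0; apply: (@run_for _ _ _ _ (fun j m1 => answers_yes m1 =
   (ints m vFail 0 == 0) && has (reached m) (iota 0 j)) q 30) => //.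
- by rewrite /answers_yes /= /upd /= h0 andbF.
- move=> j m1 jq fr vj H; rewrite iotaS_has andb_orr -H.
  have cE : beval m1 (BAnd (BILe (Var vFail) (IConst 0)) (BILe (IConst 1) (IGet aRe (Var vTau)))) =
     (ints m vFail 0 == 0) && reached m j.
    by rewrite !bevalE /= vj leqn0 (fr.1 vFail isT) (fr.1 aRe isT).
  apply: (run_if (T1 := 10)) => //; rewrite cE => h.
    by apply: run_iset => //=; rewrite h orbT.
  by apply: run_skip => //; rewrite (negbTE h) orbF.
- by rewrite leq_add2r leq_mul2l orbT.
Qed.

End Specs.

(** * The whole program and its running time *)

Definition Program : cmd :=
  Seq (SetVar vK (IGet 0 (IConst 1)))
  (Seq (SetVar vN (Suc (IGet 0 (IConst 0))))
  (Seq (SetVar vCred (IConst 1))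
  (Seq Setup
  (Seq Sort
  (Seq (If (BILe (IConst 1) (Var vCred)) Skip (SetVar vFail (IConst 1)))
  (Seq Gather
  (Seq CountWords
  (Seq Sweep Report)))))))).

Definition run_cost (N k : nat) : nat :=
  (N * 200 + 10) + ((N + budget N k) * 200 + 100) + 10 + (N * 40 + 10) +
  (k * (k * 20 + 40) + 20) + sweep_cost k N + (k ^ k * 50 + 10) + 50.

Lemma stack_eq (R : realType) (m m' : memory R) a sz :
  ints m' a =1 ints m a -> ints m' sz =1 ints m sz -> stack m' a sz = stack m a sz.
Proof. by move=> ea es; rewrite /stack es; exact: eq_mkseq. Qed.

Lemma run_program (R : realType) n k (x : n.+2.-tuple R) (s : n.-tuple crease_letter) :
  paper_strip x ->
  run Program (input x s k) (run_cost n.+1 k) (fun m => answers_yes m <->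
    exists lev : 'I_n.+1 -> nat, leveled_folded_state x s lev /\ height lev <= k).
Proof.
move=> strip; set N := n.+1; set m0 := input x s k.
set Goal' := (exists lev, _).
have solE : Goal' <-> exists lev,
    solution (seg_lo x) (seg_hi x) (crease_at x) (seg_above s) N k lev.
  split=> [[lev [h1 h2]]|[lev h]]; first exact: leveled_solution h1 h2.
  exact: solution_leveled h.
rewrite /run_cost; set c1 := N * 200 + 10; set c2 := _ * 200 + 100; set c3 := N * 40 + 10.
set c4 := k * _ + 20; set c5 := sweep_cost k N; set c6 := _ * 50 + 10.
apply: (run_seq_iset (T2 := c1 + c2 + 10 + c3 + c4 + c5 + c6 + 40)); last by rewrite /=; lia.
apply: (run_seq_iset (T2 := c1 + c2 + 10 + c3 + c4 + c5 + c6 + 30)); last by rewrite /=; lia.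
apply: (run_seq_iset (T2 := c1 + c2 + 10 + c3 + c4 + c5 + c6 + 20)); last by rewrite /=; lia.
set m1 := iset _ _ _ _.
have K1 : ints m1 vK 0 = k by [].
have N1 : ints m1 vN 0 = N by rewrite /m1 /= /upd /= addn1.
have z1 a i : a \in [:: szL; szR; vFail; aOcc; 2] -> ints m1 a i = 0.
  by rewrite !inE => /or4P[/eqP->|/eqP->|/eqP->|/orP[]/eqP->].
apply: (run_seq (T2 := c2 + 10 + c3 + c4 + c5 + c6 + 20) (run_setup strip K1 N1 _ _ _ _)) => //;
  last by rewrite /c1; lia.
move=> m2 fr2 tb.
have K2 : ints m2 vK 0 = k by rewrite (fr2.1 vK isT).
have N2 : ints m2 vN 0 = N by rewrite (fr2.1 vN isT).
have z2 a i : a \in [:: szL; szR; vFail; aOcc; 2] -> ints m2 a i = 0.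
  move=> ha; rewrite fr2.1 ?z1 //.
  by move: ha; rewrite !inE => /or4P[/eqP->|/eqP->|/eqP->|/orP[]/eqP->].
(* From here on the combinatorial lemmas are applied to the tables in memory; [solM] carries
   solutions back to the strip. *)
pose lo := reals m2 rLo; pose hi := reals m2 rHi; pose F i := reals m2 rF i.+1.
pose up := mem_above m2.
have ext i : i < N -> [/\ seg_lo x i = lo i, seg_hi x i = hi i & crease_at x i = F i].
  by move=> iN; rewrite /lo /hi /F (tb_lo tb) // (tb_hi tb) // (tb_fold tb).
have extup i : i.+1 < N -> seg_above s i = up i.
  rewrite ltnS => lt_in; rewrite /up /mem_above (tb_par tb); last exact: ltnW.
  rewrite (fr2.1 1 isT) /= /upd /= (nth_map Mountain) ?size_tuple // /seg_above.
  by case: (nth _ _ _) => /=; case: (odd i).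
have solM lev : solution (seg_lo x) (seg_hi x) (crease_at x) (seg_above s) N k lev <->
    solution lo hi F up N k lev.
  split; apply: solution_ext => // i h; first by case: (ext i h).
  by rewrite extup.
have lohi i : i < N -> (lo i < hi i)%R.
  by move=> iN; case: (ext i iN) => <- <- _; exact: seg_lo_lt_hi.
have consec i : i.+1 < N -> (lo i < hi i.+1)%R && (lo i.+1 < hi i)%R.
  move=> iN; case: (ext i (ltnW iN)) => <- <- _; case: (ext _ iN) => <- <- _.
  exact: crease_meets.
apply: (run_seq (T2 := 10 + c3 + c4 + c5 + c6 + 20)
  (run_sort (hi := hi) consec N2 (tb_cred tb) (z2 szL 0 isT) (z2 szR 0 isT) (fun=> erefl)));
  last by rewrite /c2; lia.
move=> m3 fr3 [i [zi end_i]].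
have sizes : ints m3 szL 0 + ints m3 szR 0 = i.
  by have := perm_size (zi_perm zi); rewrite size_cat size_rev !size_mkseq size_iota.
have iN := zi_le zi.
apply: (run_seq (T1 := 10) (T2 := c3 + c4 + c5 + c6 + 20)
  (Q1 := fun m4 => ints m4 vFail 0 = (ints m3 vCred 0 == 0))); last by lia.
  apply: (run_if (T1 := 5)) => //; rewrite bevalE /= => h.
    apply: run_skip => //; rewrite (fr3.1 vFail isT) z2 //.
    by case: eqP h => // ->.
  by apply: run_iset => //; rewrite /= /upd /=; move: h; rewrite -ltnNge ltnS leqn0 => ->.
move=> m4 fr4 fail4.
apply: (run_seq (run_gather m4) (T2 := c4 + c5 + c6 + 20)); last first.
  by rewrite /c3 (fr4.1 szR isT); lia.
rewrite (stack_eq (fr4.1 aL isT) (fr4.1 szL isT)) (stack_eq (fr4.1 aR isT) (fr4.1 szR isT)).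
set z := stack m3 aL szL ++ _ => m5 fr5 z5.
have K5 : ints m5 vK 0 = k by rewrite (fr5.1 vK isT) (fr4.1 vK isT) (fr3.1 vK isT).
apply: (run_seq (run_count_words K5) (T2 := c5 + c6 + 20)); last by rewrite /c4; lia.
move=> m6 fr6 Q6.
have N6 : ints m6 vN 0 = N.
  by rewrite (fr6.1 vN isT) (fr5.1 vN isT) (fr4.1 vN isT) (fr3.1 vN isT).
have F6 : ints m6 vFail 0 = (ints m3 vCred 0 == 0).
  by rewrite (fr6.1 vFail isT) (fr5.1 vFail isT).
have A6 j : ints m6 2 j = 0.
  by rewrite (fr6.1 2 isT) (fr5.1 2 isT) (fr4.1 2 isT) (fr3.1 2 isT) z2.
have same6 : [/\ forall a, a \in [:: 1; aPar; aOcc] -> ints m6 a =1 ints m2 a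
    & forall a, reals m6 a =1 reals m2 a].
  split=> [a ha j|a j]; last by rewrite fr6.2 // fr5.2 // fr4.2 // fr3.2.
  rewrite fr6.1 ?fr5.1 ?fr4.1 ?fr3.1 //; move: ha; rewrite !inE;
    by case/or3P=> /eqP->.
(* Credit 0 alone refutes a solution, even if the last segment has just been inserted. *)
case: (posnP (ints m3 vCred 0)) => [c0|cpos].
  apply: (run_seq (run_sweep_failed Q6 N6 _) (T2 := c6 + 20)); [by rewrite F6 c0| |by rewrite /c5; lia].
  move=> m7 fr7 f7.
  have Q7 : ints m7 vQ 0 = k ^ k by rewrite (fr7.1 vQ isT).
  have A7 : ints m7 2 0 = 0 by rewrite (fr7.1 2 isT).
  apply: run_weaken (run_report Q7 A7) _ _; last by rewrite /c6; lia.
  move=> m8 _ ->; rewrite eqn0Ngt f7 /=; split=> // /solE[lev /solM sol].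
  by rewrite c0 in zi; case: (zipper_broke zi sol).
have ei := end_i cpos; rewrite ei in zi.
have en6 : env k lo hi F up N z m6.
  split=> //.
  - by rewrite (fr6.1 vK isT).
  - exact: same6.2.
  - exact: same6.2.
  - by move=> j; rewrite same6.2.
  - by move=> j; rewrite /mem_above !same6.1.
  - move=> t tN; rewrite (fr6.1 aL isT) -/z -z5 nth_mkseq //.
    by have := congr1 size z5; rewrite size_mkseq => ->; rewrite (perm_size (zi_perm zi)) size_iota.
have O6 a : ints m6 aOcc a = 0 by rewrite same6.1 // z2.
have F6' : ints m6 vFail 0 = 0 by rewrite F6 eqn0Ngt cpos.
apply: (run_seq (run_sweep lohi (zi_perm zi) (zi_sorted zi) en6 O6 F6') (T2 := c6 + 20));
  last by rewrite /c5; lia.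
move=> m7 fr7 st7.
have Q7 : ints m7 vQ 0 = k ^ k by rewrite (fr7.1 vQ isT).
have A7 : ints m7 2 0 = 0 by rewrite (fr7.1 2 isT).
apply: run_weaken (run_report Q7 A7) _ _; last by rewrite /c6; lia.
move=> m8 _ ->; case: st7 => [[f7 no]|[-> inv]].
  by rewrite eqn0Ngt f7 /=; split=> // /solE[lev /solM sol]; case: (no lev sol).
have fin := sweep_final (zi_perm zi) (zi_sorted zi) inv.
rewrite eqxx /=; split=> [/hasP[v]|/solE[lev /solM sol]].
  rewrite mem_iota /= => vq rv; apply/solE.
  have [lev /solM sol] := fin.1 (ex_intro2 _ _ v vq rv).
  by exists lev.
have [v vq rv] := fin.2 (ex_intro _ lev sol).
by apply/hasP; exists v => //; rewrite mem_iota.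
Qed.

(** With $t$ the truncated logarithm, $k<2^{t+1}$ and $t+1\le 2t$ once $k\ge 2$, which turns the 5
    into 10. For $k\le 1$ both sides equal 1. *)
Lemma word_count_le k : (k ^ k) ^ 5 <= 2 ^ (10 * (k * trunc_log 2 k)).
Proof.
case: k => [|[|k]]; rewrite ?exp1n //.
set K := k.+2; have lt := trunc_log_ltn K (isT : 1 < 2).
have t1 : 0 < trunc_log 2 K by rewrite trunc_log_gt0.
rewrite -expnM; apply: (@leq_trans ((2 ^ (trunc_log 2 K).+1) ^ (K * 5))).
  by rewrite leq_exp2r ?muln_gt0 // ltnW.
by rewrite -expnM leq_exp2l //; nia.
Qed.

Lemma run_cost_le n k :
  run_cost n.+1 k <= (2 * (bcost Check4 + 4000)) * 2 ^ (10 * (k * trunc_log 2 k)) * maxn n 1.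
Proof.
have q0 := word_count_gt0 k; have kq := width_le_count k; set q := k ^ k in q0 kq *.
have q5 := word_count_le k; rewrite -/q in q5.
apply: (@leq_trans (2 * (bcost Check4 + 4000) * q ^ 5 * maxn n 1)); last first.
  by rewrite leq_mul2r leq_mul2l q5 !orbT.
rewrite /run_cost /sweep_cost /budget sum_nat_const_nat subn0 -/q.
move: (bcost Check4) => D.
have q1 : q <= q ^ 5 by rewrite -[X in X <= _]expn1 leq_pexp2l.
have q2 : q * q <= q ^ 5 by rewrite -[X in X <= _]/(q ^ 2) leq_pexp2l.
have kk : k * k <= q ^ 5 by apply: leq_trans q2; rewrite leq_mul.
move: (q ^ 5) q1 q2 kk => P q1 q2 kk.
(* There are [n.+1] segments but the bound is in [maxn n 1]; this is the factor 2 of the final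
   constant. *)
have NP : n.+1 * P <= 2 * (maxn n 1 * P) by rewrite mulnA leq_mul2r; lia.
apply: (@leq_trans ((D + 4000) * (n.+1 * P))); last by nia.
have P0 : 0 < P by lia.
have kN : n.+1 * k <= n.+1 * P by rewrite leq_mul2l; lia.
have NP1 : P <= n.+1 * P by rewrite leq_pmull.
have NP2 : n.+1 <= n.+1 * P by rewrite leq_pmulr.
have e1 : n.+1 * ((D + 2100) * P) = D * (n.+1 * P) + 2100 * (n.+1 * P).
  by rewrite mulnCA mulnDl.
have e2 : k * (k * 20 + 40) = k * k * 20 + k * 40 by rewrite mulnDr mulnA.
rewrite e1 e2 (mulnDr n.+1 k k) (mulnDl D 4000); move: (n.+1 * P) (n.+1 * k) (k * k) (D * (n.+1 * P)) kN NP1 NP2 kk => *; lia.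
Qed.

Theorem theorem3 (R : realType) :
  exists (P : cmd) (C c : nat),
    forall (n k : nat) (x : n.+2.-tuple R) (s : n.-tuple crease_letter),
      paper_strip x ->
      exists (t : nat) (m : memory R),
        [/\ exec P (input x s k) t m,
            answers_yes m <->
              (exists lev : 'I_n.+1 -> nat,
                 leveled_folded_state x s lev /\ height lev <= k)
          & t <= C * 2 ^ (c * (k * trunc_log 2 k)) * maxn n 1].
Proof.
exists Program, (2 * (bcost Check4 + 4000)), 10 => n k x s strip.
have [t [m [ex le ans]]] := run_program k s strip.
by exists t, m; split=> //; apply: leq_trans le (run_cost_le n k).
Qed.
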